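(* Let $\sigma>0$ and $\theta\in[0,2\pi)$. Let $\mathcal M=\mathcal M_0\oplus\mathcal M_1$, with $\mathcal M_0\subseteq H^2(\mathbb D^2)$ and $\mathcal M_1\subseteq H^2(\mathbb D)\oplus\mathbb C$, be a closed invariant subspace of the $3$-Brownian shift $T_{\sigma,\theta}$, where $\mathcal M_1$ is a nonzero invariant subspace of the Brownian shift $B_{\sigma,\theta}$. Then $\mathcal M_0$ must be of one of the following forms: (1) If $\mathcal M_1=\varphi H^2(\mathbb D)\oplus\{0\}$, where $\varphi\in H^\infty(\mathbb D)$ is an inner function, then there exist a Hilbert space $\mathcal E_{\mathcal M}$ and an operator-valued inner function $\Psi\in H^\infty(\mathbb D;\mathcal B(\mathcal E_{\mathcal M},K_\varphi))$ such that $$\mathcal M_0=\varphi_{z_2}H^2(\mathbb D^2)\oplus\Psi H^2(\mathbb D;\mathcal E_{\mathcal M}).$$ (2) If $\mathcal M_1=\mathbb C\begin{bmatrix}g\\1\end{bmatrix}\oplus(\varphi H^2(\mathbb D)\oplus\{0\})$, where $\varphi\in H^\infty(\mathbb D)$ is an inner function such that $\varphi(e^{i\theta})$ exists, and $$g(z)=\sigma\left(\frac{\overline{\varphi(e^{i\theta})}\,\varphi(z)-1}{z-e^{i\theta}}\right),\qquad z\in\mathbb D,$$ then there exist a Hilbert space $\mathcal E_{\mathcal M}$ and an operator-valued inner function $\Psi\in H^\infty(\mathbb D;\mathcal B(\mathcal E_{\mathcal M},K_\varphi))$ such that $$\mathcal M_0=\varphi_{z_2}H^2(\mathbb D^2)\oplus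 g_{z_2}H^2_{z_1}(\mathbb D)\oplus\Psi H^2(\mathbb D;\mathcal E_{\mathcal M}),$$ with $\Psi(0)\mathcal E_{\mathcal M}\subset g^\perp\subset K_\varphi$.
   Context: All Hilbert spaces are complex and separable (possibly $\{0\}$); $\oplus$ denotes orthogonal direct sum. $H^2(\mathbb D)$, $H^2(\mathbb D^2)$ are the Hardy spaces of the unit disk and bidisk (power series with square-summable coefficients, $\ell^2$ coefficient norm); $H^2(\mathbb D;E)$ is the $E$-valued Hardy space; $H^\infty(\mathbb D;\mathcal B(E,F))$ is the space of bounded analytic $\mathcal B(E,F)$-valued functions. $\Psi\in H^\infty(\mathbb D;\mathcal B(E,F))$ is inner if $M_\Psi:H^2(\mathbb D;E)\to H^2(\mathbb D;F)$, $(M_\Psi f)(z)=\Psi(z)f(z)$, is an isometry. For a scalar inner $\varphi$, $K_\varphi:=H^2(\mathbb D)\ominus\varphi H^2(\mathbb D)$. The Brownian shift on $H^2(\mathbb D)\oplus\mathbb C$ is $B_{\sigma,\theta}(f,\alpha)=(zf+\sigma\alpha,\ e^{i\theta}\alpha)$. The $3$-Brownian shift on $H^2(\mathbb D^2)\oplus H^2(\mathbb D)\oplus\mathbb C$ is $T_{\sigma,\theta}(F,f,\alpha)=(z_1F+\sigma f_{z_2},\ zf+\sigma\alpha,\ e^{i\theta}\alpha)$. For a one-variable function $f$, $f_{z_2}(z_1,z_2):=f(z_2)$. $H^2_{z_1}(\mathbb D)\subset H^2(\mathbb D^2)$ is the closed subspace of functions $(z_1,z_2)\mapsto h(z_1)$,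 $h\in H^2(\mathbb D)$. We identify $H^2(\mathbb D^2)\cong H^2(\mathbb D;H^2(\mathbb D))$ with respect to the variable $z_1$ (values being functions of $z_2$), so $H^2(\mathbb D;K_\varphi)\subset H^2(\mathbb D^2)$. By a known theorem of Agler and Stankus, every nonzero closed invariant subspace $\mathcal M_1$ of $B_{\sigma,\theta}$ has the form in (1) or the form in (2); in (2), $g\in H^2(\mathbb D)$ and $g\perp\varphi H^2(\mathbb D)$, so $g\in K_\varphi$, and $g^\perp$ denotes the orthogonal complement of $g$ in $K_\varphi$. *)

(* Defs.v *)
From HB Require Import structures.
From mathcomp Require Import all_boot all_order all_algebra sesquilinear.
From mathcomp Require Import ring lra.
From mathcomp Require Import all_classical all_reals all_analysis.
From mathcomp Require Import complex.

Set Implicit Arguments.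
Unset Strict Implicit.
Unset Printing Implicit Defensive.

Import Order.TTheory GRing.Theory Num.Theory.
Import numFieldNormedType.Exports.
Local Open Scope classical_set_scope.
Local Open Scope complex_scope.
Local Open Scope ring_scope.

HB.instance Definition _ (R : realType) := NormedModule.copy R[i] R[i]^o.

Section complex_complete.
Variable R : realType.
Local Notation C := R[i].
Implicit Types (z : C) (e : R).

Lemma normC_le z : `|z| <= (`|complex.Re z| + `|complex.Im z|)%:C.
Proof.
have nC (x : R) : `|x%:C| = `|x|%:C :> C.
  by rewrite normc_def/= expr0n addr0 sqrtr_sqr.
rewrite [z in `|z|]complexE (le_trans (ler_normD _ _))// normrM.
have -> : `|'i%C : C| = 1 by rewrite normc_def/= expr0n add0r expr1n sqrtr1.
by rewrite mul1r rmorphD /= !nC.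
Qed.

Lemma normC_Re z : `|complex.Re z|%:C <= `|z|.
Proof. exact: normc_ge_Re. Qed.

Lemma normC_Im z : `|complex.Im z|%:C <= `|z|.
Proof.
rewrite normc_def lecR -sqrtr_sqr ler_wsqrtr// lerDr sqr_ge0//.
Qed.

Lemma gt0_complex (e : C) : 0 < e -> exists2 r : R, 0 < r & e = r%:C.
Proof.
move=> e0; exists (complex.Re e); last first.
  by rewrite RRe_real// gtr0_real.
by rewrite -ltcR RRe_real ?gtr0_real.
Qed.

Lemma cvgC (T : Type) (F : set_system T) {FF : Filter F} (f : T -> C) (a : C) :
  (complex.Re (f x)) @[x --> F] --> complex.Re a ->
  (complex.Im (f x)) @[x --> F] --> complex.Im a -> f x @[x --> F] --> a.
Proof.
move=> /cvgrPdist_lt fre /cvgrPdist_lt fim.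
apply/cvgrPdist_lt => _ /gt0_complex[e e0 ->].
have e20 : 0 < e / 2 by rewrite divr_gt0.
near=> x; apply: le_lt_trans (normC_le _) _; rewrite ltcR [e]splitr.
apply: ltrD.
  suff : `|complex.Re a - complex.Re (f x)| < e / 2.
    by rewrite (_ : complex.Re (a - f x) = complex.Re a - complex.Re (f x))//;
      case: (a); case: (f x).
  by near: x; apply: fre.
suff : `|complex.Im a - complex.Im (f x)| < e / 2.
  by rewrite (_ : complex.Im (a - f x) = complex.Im a - complex.Im (f x))//;
    case: (a); case: (f x).
by near: x; apply: fim.
Unshelve. all: by end_near. Qed.

Lemma C_complete (F : set_system C) : ProperFilter F -> cauchy F -> cvg F.
Proof.
move=> FF /cauchy_ballP FC.
have ReB z w : complex.Re (z - w) = complex.Re z - complex.Re w by case: z; case: w.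
have ImB z w : complex.Im (z - w) = complex.Im z - complex.Im w by case: z; case: w.
have cRe : cvg (complex.Re x @[x --> F]).
  apply: cauchy_cvg; apply/cauchy_ballP => e e0.
  have ec0 : 0 < e%:C :> C by rewrite ltcR.
  have [[A B] /= [FA FB] AB] := FC _ ec0.
  exists ([set complex.Re x | x in A], [set complex.Re x | x in B]).
    by split; [apply: filterS FA|apply: filterS FB] => x /=; exists x.
  move=> [_ _] /= [[x Ax <-] [y By <-]]; rewrite /ball/= -ReB -ltcR.
  apply: le_lt_trans (normC_Re _) _.
  exact: (AB (x, y)).
have cIm : cvg (complex.Im x @[x --> F]).
  apply: cauchy_cvg; apply/cauchy_ballP => e e0.
  have ec0 : 0 < e%:C :> C by rewrite ltcR.
  have [[A B] /= [FA FB] AB] := FC _ ec0.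
  exists ([set complex.Im x | x in A], [set complex.Im x | x in B]).
    by split; [apply: filterS FA|apply: filterS FB] => x /=; exists x.
  move=> [_ _] /= [[x Ax <-] [y By <-]]; rewrite /ball/= -ImB -ltcR.
  apply: le_lt_trans (normC_Im _) _.
  exact: (AB (x, y)).
case/cvg_ex: cRe => a aP; case/cvg_ex: cIm => b bP.
by apply/cvg_ex; exists (a +i* b); apply: (@cvgC C F _ id).
Qed.

End complex_complete.

HB.instance Definition _ (R : realType) :=
  Uniform_isComplete.Build R[i] (@C_complete R).

Section inner_product_norm.
Variables (R : realType) (V : lmodType R[i]) (d : {dot V for Num.conj}).
Local Notation C := R[i].

Definition dot_norm (x : V) : C := sqrtC (d x x).

Lemma dot_norm_ge0 x : 0 <= dot_norm x.
Proof. by rewrite sqrtC_ge0 dnorm_ge0. Qed.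

Lemma dot_norm_sqr x : dot_norm x ^+ 2 = d x x.
Proof. exact: sqrtCK. Qed.

Lemma dot_cauchy_schwarz x y : `|d x y| <= dot_norm x * dot_norm y.
Proof.
have [->|y0] := eqVneq y 0.
  by rewrite linear0r normr0 mulr_ge0// dot_norm_ge0.
have y0' : 0 < d y y by rewrite dnorm_gt0.
have yc : (d y y)^* = d y y by rewrite conj_Creal// gtr0_real.
have : 0 <= d (x - (d x y / d y y) *: y) (x - (d x y / d y y) *: y).
  exact: dnorm_ge0.
rewrite dnormB dnormZ linearZr_LR /= !rmorphM /= !conjCK.
rewrite fmorphV /= yc normrM normfV (gtr0_norm y0').
rewrite exprMn exprVn.
have -> : `|d x y| ^+ 2 = d x y * (d x y)^* by rewrite normCK.
set a := d x y; set b := d y y => H.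
have {}H : a * a^* <= d x x * b.
  rewrite -ler_pdivrMr// -subr_ge0; move: H.
  congr (0 <= _).
  have b0 : b != 0 by rewrite gt_eqF.
  by field.
rewrite -(@ler_pXn2r _ 2)// ?nnegrE ?mulr_ge0 ?dot_norm_ge0//.
by rewrite exprMn !dot_norm_sqr normCK.
Qed.

Lemma dot_normD x y : dot_norm (x + y) <= dot_norm x + dot_norm y.
Proof.
rewrite -(@ler_pXn2r _ 2)// ?nnegrE ?addr_ge0 ?dot_norm_ge0//.
rewrite dot_norm_sqr dnormD sqrrD !dot_norm_sqr -addrA [leRHS]addrAC -addrA.
rewrite lerD2l lerD2l.
have -> : d x y + (d x y)^* = 'Re (d x y) *+ 2.
  by rewrite -mulr_natr ReE -mulrA mulVf ?mulr1// pnatr_eq0.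
rewrite lerMn2r orFb.
apply: le_trans (dot_cauchy_schwarz x y).
by rewrite (leif_le (leif_Re_Creal _)).
Qed.

Lemma dot_normZ a x : dot_norm (a *: x) = `|a| * dot_norm x.
Proof.
rewrite /dot_norm dnormZ sqrtCM ?sqrCK//.
- by rewrite nnegrE exprn_ge0.
- by rewrite nnegrE dnorm_ge0.
Qed.

Lemma dot_norm_eq0 x : dot_norm x = 0 -> x = 0.
Proof. by move=> /eqP; rewrite sqrtC_eq0 dnorm_eq0 => /eqP. Qed.

End inner_product_norm.

(* Complex Hilbert spaces; the inner product is linear in its first argument. *)
HB.mixin Record CompleteNormedModule_isHilbert (R : realType) V
    of CompleteNormedModule R[i] V := {
  hdot : {dot V for Num.conj} ;
  hdotE : forall x : V, hdot x x = `|x| ^+ 2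
}.

#[short(type="hilbertType")]
HB.structure Definition Hilbert (R : realType) :=
  {V of CompleteNormedModule R[i] V & CompleteNormedModule_isHilbert R V}.

Section complex_hilbert.
Variable R : realType.
Local Notation C := R[i].

Definition cdot (x y : C) : C := x * y^*.

Let cdot_bilinear : bilinear_for *%R (Num.conj \; *%R) cdot.
Proof.
split=> u a x y; rewrite /cdot /=.
  by rewrite mulrDl mulrA.
by rewrite rmorphD rmorphM /= mulrDr mulrCA.
Qed.

HB.instance Definition _ := bilinear_isBilinear.Build C C C C *%R
  (Num.conj \; *%R) cdot cdot_bilinear.

Let cdot_hermitian x y : cdot x y = (-1) ^+ false * (cdot y x)^*.
Proof. by rewrite mul1r /cdot rmorphM /= conjCK mulrC. Qed.

HB.instance Definition _ := isHermitianSesquilinear.Build C C false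
  Num.conj cdot cdot_hermitian.

Let cdot_gt0 x : x != 0 -> 0 < cdot x x.
Proof. by move=> x0; rewrite /cdot -normCK exprn_gt0// normr_gt0. Qed.

HB.instance Definition _ := isDotProduct.Build C C cdot cdot_gt0.

Let cdotE x : cdot x x = `|x| ^+ 2.
Proof. by rewrite normCK. Qed.

HB.instance Definition _ := CompleteNormedModule_isHilbert.Build R C cdotE.

End complex_hilbert.

Section complex_series.
Variable R : realType.
Local Notation C := R[i].

Lemma cvgC_le (T : Type) (F : set_system T) {FF : ProperFilter F} (f : T -> C)
    (a b : C) :
  f x @[x --> F] --> a -> (\forall x \near F, f x <= b) -> a <= b.
Proof.
move=> /cvgrPdist_lt fa fb.
have h e : 0 < e -> exists x, `|a - f x| < e /\ f x <= b.
  move=> e0; have : \forall x \near F, `|a - f x| < e /\ f x <= b.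
    by near=> x; split; [near: x; exact: fa|near: x].
  by move=> /filter_ex.
have small (x : R) : (forall e, 0 < e -> x < e) -> x <= 0.
  by move=> xe; rewrite leNgt; apply/negP => /xe; rewrite ltxx.
have hIm : complex.Im b = complex.Im a.
  apply/eqP; rewrite -subr_eq0 -normr_le0; apply: small => e e0.
  have ec : 0 < e%:C :> C by rewrite ltcR.
  have [x [xe]] := h _ ec.
  rewrite lecE => /andP[/eqP -> _].
  rewrite -ltcR; apply: le_lt_trans xe.
  rewrite distrC; apply: le_trans (normC_Im _).
  by case: (a); case: (f x).
have hRe : complex.Re a <= complex.Re b.
  rewrite -subr_le0; apply: small => e e0.
  have ec : 0 < e%:C :> C by rewrite ltcR.
  have [x [xe]] := h _ ec.
  rewrite lecE => /andP[_ fxb]; rewrite -ltcR; apply: le_lt_trans xe.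
  apply: le_trans (normC_Re _); rewrite lecR.
  rewrite (_ : complex.Re (a - f x) = complex.Re a - complex.Re (f x)); last first.
    by case: (a); case: (f x).
  by apply: le_trans (ler_norm _); rewrite lerB.
by rewrite lecE hIm eqxx.
Unshelve. all: by end_near. Qed.

Lemma is_cvg_seriesC (u : nat -> C) (M : C) :
  (forall n, \sum_(0 <= k < n) `|u k| <= M) -> cvgn (series u).
Proof.
move=> uM.
have RM (g : C -> R) : (forall z, `|g z|%:C <= `|z|) ->
    cvgn (series (fun k => g (u k))).
  move=> gle; apply: normed_cvg; apply: nondecreasing_is_cvgn.
    apply/nondecreasing_seqP => n.
    by rewrite [leRHS]seriesSr lerDl /=.
  exists (complex.Re M) => _ [n _ <-].
  have M0 : M \is Num.real by apply: ger0_real; have := uM 0%N; rewrite big_geq.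
  rewrite /= -lecR RRe_real// (le_trans _ (uM n))// rmorph_sum /=.
  by apply: ler_sum => k _.
have /cvg_ex[a aP] := RM (@complex.Re R) (@normC_Re R).
have /cvg_ex[b bP] := RM (@complex.Im R) (@normC_Im R).
apply/cvg_ex; exists (a +i* b); apply: cvgC.
  rewrite (_ : (fun n => _) = series (fun k => complex.Re (u k)))//.
  apply/funext => n; rewrite /series /=.
  elim: n => [|n IH]; first by rewrite !big_geq.
  rewrite !big_nat_recr//= -IH.
  by case: (u n); case: (\sum_(0 <= k < n) u k).
rewrite (_ : (fun n => _) = series (fun k => complex.Im (u k)))//.
apply/funext => n; rewrite /series /=.
elim: n => [|n IH]; first by rewrite !big_geq.
rewrite !big_nat_recr//= -IH.
by case: (u n); case: (\sum_(0 <= k < n) u k).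
Qed.

Lemma cvg_conjC (T : Type) (F : set_system T) {FF : Filter F} (f : T -> C) a :
  f x @[x --> F] --> a -> (f x)^* @[x --> F] --> a^*.
Proof.
move=> /cvgrPdist_lt fa; apply/cvgrPdist_lt => e e0; near=> x.
by rewrite -rmorphB /= norm_conjC; near: x; apply: fa.
Unshelve. all: by end_near. Qed.

Lemma cvg_sumC (T : Type) (F : set_system T) {FF : Filter F}
    (u : nat -> T -> C) (a : nat -> C) n :
  (forall k, u k x @[x --> F] --> a k) ->
  (\sum_(0 <= k < n) u k x) @[x --> F] --> \sum_(0 <= k < n) a k.
Proof.
move=> ua; elim: n => [|n IH].
  rewrite big_geq// (_ : (fun x => _) = fun=> 0); first exact: cvg_cst.
  by apply/funext => x; rewrite big_geq.
rewrite (big_nat_recr n 0); last by [].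
have -> : (fun x => \sum_(0 <= k < n.+1) u k x) =
    (fun x => \sum_(0 <= k < n) u k x + u n x).
  by apply/funext => x; rewrite (big_nat_recr n 0).
exact: cvgD IH (ua n).
Qed.

End complex_series.

Section hilbert_theory.
Variables (R : realType) (E : hilbertType R).
Local Notation C := R[i].
Implicit Types x y : E.

Lemma hdot_norm_le x y : `|hdot x y| <= `|x| * `|y|.
Proof.
have nE (z : E) : dot_norm hdot z = `|z|.
  by rewrite /dot_norm hdotE sqrCK.
by have := dot_cauchy_schwarz hdot x y; rewrite !nE.
Qed.

End hilbert_theory.

(* The Hardy space [H^2(D; E)], an element being given by its Taylor
   coefficients at 0. *)
Section hardy_def.
Variables (R : realType) (E : hilbertType R).
Local Notation C := R[i].

Definition square_summable (a : nat -> E) : Prop :=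
  exists M : C, forall n, \sum_(0 <= k < n) `|a k| ^+ 2 <= M.

Definition square_summableb : {pred nat -> E} :=
  [pred a | `[< square_summable a >]].

Record hardy := Hardy {
  coef :> nat -> E ;
  coefP : coef \in square_summableb }.

HB.instance Definition _ := [isSub for coef].
HB.instance Definition _ := [Choice of hardy by <:].

Lemma square_summable_submod_closed : submod_closed square_summableb.
Proof.
split; first by rewrite inE; exists 0 => n; rewrite big1// => k _;
  rewrite normr0 expr0n.
move=> c a b; rewrite !inE => -[M aM] [N bN].
exists ((`|c| ^+ 2 * M + N) *+ 2) => n.
apply: (@le_trans _ _ (\sum_(0 <= k < n)
    ((`|c| ^+ 2 * `|a k| ^+ 2 + `|b k| ^+ 2) *+ 2))).
  apply: ler_sum => k _.
  have h : `|(c *: a + b) k| <= `|c| * `|a k| + `|b k|.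
    by rewrite (le_trans (ler_normD _ _))// normrZ.
  apply: (@le_trans _ _ ((`|c| * `|a k| + `|b k|) ^+ 2)).
    by rewrite ler_pXn2r// nnegrE ?addr_ge0 ?mulr_ge0.
  rewrite /= -subr_ge0 -exprMn.
  rewrite (_ : _ - _ = (`|c| * `|a k| - `|b k|) ^+ 2); last by ring.
  by rewrite -realEsqr realB ?realM ?normr_real.
rewrite sumrMnl lerMn2r orFb big_split /=.
rewrite -mulr_sumr; apply: lerD; last exact: bN.
by apply: ler_wpM2l; [rewrite exprn_ge0|exact: aM].
Qed.

HB.instance Definition _ :=
  GRing.isSubmodClosed.Build C (nat -> E) square_summableb
    square_summable_submod_closed.
HB.instance Definition _ := [SubChoice_isSubLmodule of hardy by <:].

End hardy_def.
Arguments square_summableb {R E}.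

Section hardy_norm.
Variables (R : realType) (E : hilbertType R).
Local Notation C := R[i].
Implicit Types (f g h : hardy E) (c : C).

Lemma coefB f g k : (f - g) k = f k - g k. Proof. by []. Qed.
Lemma coefZD c f g k : (c *: f + g) k = c *: f k + g k. Proof. by []. Qed.

Lemma hardyP f g : (forall k, f k = g k) -> f = g.
Proof. by move=> fg; apply/val_inj/funext. Qed.

Lemma coef_summable f : square_summable f.
Proof. by have := coefP f; rewrite inE. Qed.

Definition hardy_dot f g : C := limn (series (fun k => hdot (f k) (g k))).

Lemma hardy_dot_cvg f g :
  series (fun k => hdot (f k) (g k)) @ \oo --> hardy_dot f g.
Proof.
have [[M fM] [N gN]] := (coef_summable f, coef_summable g).
apply: (@is_cvg_seriesC _ _ (M + N)) => n.
apply: (@le_trans _ _ (\sum_(0 <= k < n) (`|f k| ^+ 2 + `|g k| ^+ 2))).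
  apply: ler_sum => k _; apply: le_trans (hdot_norm_le _ _) _.
  set a := `|f k|; set b := `|g k|.
  have [a0 b0] : 0 <= a /\ 0 <= b by rewrite !normr_ge0.
  apply: (@le_trans _ _ ((a * b) *+ 2)).
    by rewrite mulr2n lerDl mulr_ge0.
  rewrite -subr_ge0 (_ : _ - _ = (a - b) ^+ 2); last by ring.
  by rewrite -realEsqr realB ?ger0_real.
by rewrite big_split; apply: lerD; [exact: fM|exact: gN].
Qed.

Lemma hardy_dotE f g a :
  series (fun k => hdot (f k) (g k)) @ \oo --> a -> hardy_dot f g = a.
Proof. by move=> fga; apply: cvg_lim => //; exact: norm_hausdorff. Qed.

Let hardy_dot_hermitian f g : hardy_dot f g = (-1) ^+ false * (hardy_dot g f)^*.
Proof.
rewrite mul1r; apply: hardy_dotE.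
rewrite (_ : series _ = (fun n => (series (fun k => hdot (g k) (f k)) n)^*)).
  exact: cvg_conjC (@hardy_dot_cvg g f).
apply/funext => n; rewrite /series /= rmorph_sum /=.
by apply: eq_bigr => k _; rewrite [LHS]hermC mul1r.
Qed.

Let hardy_dot_linear h : linear_for *%R (hardy_dot^~ h).
Proof.
move=> c f g; apply: hardy_dotE.
rewrite (_ : series _ = (fun n => c * series (fun k => hdot (f k) (h k)) n +
                                  series (fun k => hdot (g k) (h k)) n)).
  apply: cvgD; last exact: hardy_dot_cvg.
  by apply: cvgM; [exact: cvg_cst|exact: hardy_dot_cvg].
apply/funext => n; rewrite /series /= mulr_sumr -big_split /=.
by apply: eq_bigr => k _; rewrite linearPl.
Qed.

Let hardy_dot_bilinear : bilinear_for *%R (Num.conj \; *%R) hardy_dot.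
Proof.
split=> [h c f g|h c f g]; first exact: hardy_dot_linear.
rewrite hardy_dot_hermitian mul1r hardy_dot_linear.
rewrite rmorphD rmorphM /=.
by rewrite [hardy_dot h f]hardy_dot_hermitian [hardy_dot h g]hardy_dot_hermitian
  !mul1r.
Qed.

HB.instance Definition _ := bilinear_isBilinear.Build C (hardy E) (hardy E) C
  *%R (Num.conj \; *%R) hardy_dot hardy_dot_bilinear.
HB.instance Definition _ := isHermitianSesquilinear.Build C (hardy E) false
  Num.conj hardy_dot hardy_dot_hermitian.

Lemma cvgC_ge (u : nat -> C) (a : C) m :
  u @ \oo --> a -> (forall n, (m <= n)%N -> u m <= u n) -> u m <= a.
Proof.
move=> /cvgN ua um; rewrite -lerN2.
apply: (cvgC_le ua); exists m => // n /= mn.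
by rewrite lerN2 um.
Qed.

Lemma partial_sum_le f n : \sum_(0 <= k < n) `|f k| ^+ 2 <= hardy_dot f f.
Proof.
have dotE m : series (fun k => hdot (f k) (f k)) m =
              \sum_(0 <= k < m) `|f k| ^+ 2.
  by rewrite /series /=; apply: eq_bigr => k _; rewrite hdotE.
rewrite -dotE; apply: cvgC_ge (@hardy_dot_cvg f f) _ => m nm.
rewrite !dotE (big_cat_nat (leq0n n) nm) //= lerDl.
by apply: sumr_ge0 => k _; rewrite exprn_ge0.
Qed.

Let hardy_dot_gt0 f : f != 0 -> 0 < hardy_dot f f.
Proof.
move=> f0; have [k fk0] : exists k, f k != 0.
  apply/not_existsP => fk; move/negP: f0; apply; apply/eqP/hardyP => k.
  by apply/eqP; rewrite -[_ == _]negbK; apply/negP/fk.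
apply: lt_le_trans (partial_sum_le f k.+1).
rewrite big_nat_recr//= ltr_wpDl//; first by rewrite sumr_ge0.
by rewrite exprn_gt0// normr_gt0.
Qed.

HB.instance Definition _ := isDotProduct.Build C (hardy E) hardy_dot
  hardy_dot_gt0.

HB.instance Definition _ := Lmodule_isNormed.Build C (hardy E)
  (dot_normD hardy_dot) (dot_normZ hardy_dot) (@dot_norm_eq0 _ _ hardy_dot).

Lemma hardy_normE f : `|f| ^+ 2 = hardy_dot f f.
Proof. exact: dot_norm_sqr. Qed.

Lemma coef_norm_le f k : `|f k| <= `|f|.
Proof.
rewrite -(@ler_pXn2r _ 2)// ?nnegrE// hardy_normE.
apply: le_trans (partial_sum_le f k.+1).
by rewrite big_nat_recr//= lerDr sumr_ge0.
Qed.

Lemma hardy_norm_le f (M : C) : 0 <= M ->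
  (forall n, \sum_(0 <= k < n) `|f k| ^+ 2 <= M ^+ 2) -> `|f| <= M.
Proof.
move=> M0 fM; rewrite -(@ler_pXn2r _ 2)// ?nnegrE// hardy_normE.
apply: (cvgC_le (@hardy_dot_cvg f f)); near=> n.
by rewrite /series /=; under eq_bigr do rewrite hdotE; exact: fM.
Unshelve. all: by end_near. Qed.

Lemma hardy_complete (F : set_system (hardy E)) :
  ProperFilter F -> cauchy F -> cvg F.
Proof.
move=> FF /cauchy_ballP FC.
have cF k : cvg (f k @[f --> F]).
  apply: cauchy_cvg; apply/cauchy_ballP => e e0.
  have [[A B] /= [FA FB] AB] := FC _ e0.
  exists ([set f k | f in A], [set f k | f in B]).
    by split; [apply: filterS FA|apply: filterS FB] => f /=; exists f.
  move=> [_ _] /= [[f Af <-] [g Bg <-]]; have := AB (f, g) (conj Af Bg).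
  rewrite -!ball_normE /= => fge; apply: le_lt_trans fge.
  exact: (coef_norm_le (f - g)).
pose a k := lim (f k @[f --> F]).
have close e : 0 < e -> exists2 A, F A & forall f, A f -> forall n,
    \sum_(0 <= k < n) `|f k - a k| ^+ 2 <= e ^+ 2.
  move=> e0; have [[A B] /= [FA FB] AB] := FC _ e0.
  exists A => // f Af n.
  have : (\sum_(0 <= k < n) `|f k - g k| ^+ 2) @[g --> F] -->
         \sum_(0 <= k < n) `|f k - a k| ^+ 2.
    have h k : `|f k - g k| @[g --> F] --> `|f k - a k|.
      by apply: cvg_norm; apply: cvgB; [exact: cvg_cst|exact: cF].
    have h2 k : `|f k - g k| ^+ 2 @[g --> F] --> `|f k - a k| ^+ 2.
      exact: cvgM (h k) (h k).
    exact: (@cvg_sumC _ _ _ _ (fun k (g : hardy E) => `|f k - g k| ^+ 2)).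
  move=> /cvgC_le; apply; apply: filterS FB => g Bg.
  have := AB (f, g) (conj Af Bg); rewrite -ball_normE /= => /ltW fge.
  apply: le_trans (partial_sum_le (f - g) n) _.
  by rewrite -hardy_normE ler_pXn2r ?nnegrE ?normr_ge0 ?(ltW e0) //;
    exact: ltW.
have aP : a \in square_summableb.
  have [A FA Ale] := close 1 ltr01; have [f Af] := filter_ex FA.
  have fa : (coef f - a) \in square_summableb.
    by rewrite inE; exists (1 ^+ 2); exact: Ale.
  rewrite (_ : a = coef f - (coef f - a)); last by rewrite subKr.
  by rewrite rpredB ?coefP.
apply/cvg_ex; exists (Hardy aP); apply/cvgrPdist_le => e e0.
have [A FA Ale] := close e e0.
apply: filterS FA => f Af; rewrite distrC; apply: hardy_norm_le; first exact: ltW.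
exact: Ale.
Qed.

HB.instance Definition _ := Uniform_isComplete.Build (hardy E) hardy_complete.
HB.instance Definition _ :=
  CompleteNormedModule_isHilbert.Build R (hardy E) (fun f => esym (hardy_normE f)).

End hardy_norm.

(* The orthogonal direct sum of two Hilbert spaces: an alias of the product
   type, whose library norm is the max norm, carrying the Hilbert norm. *)
Definition hsum (R : realType) (E F : hilbertType R) : Type := (E * F)%type.

Section hsum_hilbert.
Variables (R : realType) (E F : hilbertType R).
Local Notation C := R[i].
Local Notation V := (hsum E F).

HB.instance Definition _ := GRing.Lmodule.copy V (E * F)%type.

Definition hsum_dot (x y : V) : C := hdot x.1 y.1 + hdot x.2 y.2.

Let hsum_dot_bilinear : bilinear_for *%R (Num.conj \; *%R) hsum_dot.
Proof.
split=> u a x y; rewrite /hsum_dot /=.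
  by rewrite !linearPl /=; ring.
by rewrite !linearPr /=; ring.
Qed.

HB.instance Definition _ := bilinear_isBilinear.Build C V V C *%R
  (Num.conj \; *%R) hsum_dot hsum_dot_bilinear.

Let hsum_dot_hermitian x y : hsum_dot x y = (-1) ^+ false * (hsum_dot y x)^*.
Proof.
rewrite mul1r /hsum_dot rmorphD /=; congr (_ + _).
  by rewrite [LHS]hermC mul1r.
by rewrite [LHS]hermC mul1r.
Qed.

HB.instance Definition _ := isHermitianSesquilinear.Build C V false
  Num.conj hsum_dot hsum_dot_hermitian.

Let hsum_dot_gt0 x : x != 0 -> 0 < hsum_dot x x.
Proof.
case: x => x y xy0; rewrite /hsum_dot !hdotE /=.
have [x0|x0] := eqVneq x 0; last first.
  by rewrite ltr_wpDr ?exprn_ge0 ?exprn_gt0 ?normr_gt0.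
have [y0|y0] := eqVneq y 0; last first.
  by rewrite ltr_wpDl ?exprn_ge0 ?exprn_gt0 ?normr_gt0.
by move: xy0; rewrite x0 y0 eqxx.
Qed.

HB.instance Definition _ := isDotProduct.Build C V hsum_dot hsum_dot_gt0.
HB.instance Definition _ := Lmodule_isNormed.Build C V
  (dot_normD hsum_dot) (dot_normZ hsum_dot) (@dot_norm_eq0 _ _ hsum_dot).

Lemma hsum_normE (x : V) : `|x| ^+ 2 = hsum_dot x x.
Proof. exact: dot_norm_sqr. Qed.

Lemma hsum_norm1 (x : V) : `|x.1| <= `|x|.
Proof.
rewrite -(@ler_pXn2r _ 2)// ?nnegrE// hsum_normE /hsum_dot !hdotE.
by rewrite lerDl exprn_ge0.
Qed.

Lemma hsum_norm2 (x : V) : `|x.2| <= `|x|.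
Proof.
rewrite -(@ler_pXn2r _ 2)// ?nnegrE// hsum_normE /hsum_dot !hdotE.
by rewrite lerDr exprn_ge0.
Qed.

Lemma hsum_norm_le (x : V) : `|x| <= `|x.1| + `|x.2|.
Proof.
rewrite -(@ler_pXn2r _ 2)// ?nnegrE ?addr_ge0// hsum_normE /hsum_dot !hdotE.
by rewrite sqrrD addrAC lerDl mulrn_wge0// mulr_ge0.
Qed.

Lemma hsum_complete (G : set_system V) : ProperFilter G -> cauchy G -> cvg G.
Proof.
move=> GG /cauchy_ballP GC.
have c1 : cvg ((x : V).1 @[x --> G]).
  apply: cauchy_cvg; apply/cauchy_ballP => e e0.
  have [[A B] /= [GA GB] AB] := GC _ e0.
  exists ([set x.1 | x in A], [set x.1 | x in B]).
    by split; [apply: filterS GA|apply: filterS GB] => x /=; exists x.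
  move=> [_ _] /= [[x Ax <-] [y By <-]]; have := AB (x, y) (conj Ax By).
  rewrite -!ball_normE /= => xye; apply: le_lt_trans xye.
  exact: (hsum_norm1 (x - y)).
have c2 : cvg ((x : V).2 @[x --> G]).
  apply: cauchy_cvg; apply/cauchy_ballP => e e0.
  have [[A B] /= [GA GB] AB] := GC _ e0.
  exists ([set x.2 | x in A], [set x.2 | x in B]).
    by split; [apply: filterS GA|apply: filterS GB] => x /=; exists x.
  move=> [_ _] /= [[x Ax <-] [y By <-]]; have := AB (x, y) (conj Ax By).
  rewrite -!ball_normE /= => xye; apply: le_lt_trans xye.
  exact: (hsum_norm2 (x - y)).
case/cvg_ex: c1 => a /cvgrPdist_lt aP; case/cvg_ex: c2 => b /cvgrPdist_lt bP.
apply/cvg_ex; exists ((a, b) : V); apply/cvgrPdist_lt => e e0.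
have e20 : 0 < e / 2 by rewrite divr_gt0.
near=> x; apply: le_lt_trans (hsum_norm_le _) _; rewrite [e]splitr.
by apply: ltrD; near: x; [exact: aP|exact: bP].
Unshelve. all: by end_near. Qed.

HB.instance Definition _ := Uniform_isComplete.Build V hsum_complete.
HB.instance Definition _ :=
  CompleteNormedModule_isHilbert.Build R V (fun x => esym (hsum_normE x)).

End hsum_hilbert.

Section hilbert_geometry.
Variables (R : realType) (E : hilbertType R).
Implicit Types A B D M : set E.

Definition separable : Prop := exists2 D : set E, countable D & dense D.

Definition closed_subspace A : Prop :=
  [/\ closed A, A 0 & forall (c : R[i]) x y, A x -> A y -> A (c *: x + y)].

Definition invariant_under (T : E -> E) A : Prop := T @` A `<=` A.

Definition orth A B : Prop := forall x y, A x -> B y -> hdot x y = 0.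

Definition orthc A : set E := [set x | forall y, A y -> hdot x y = 0].

Definition sumset A B : set E := [set x + y | x in A & y in B].

(* [M = A ⊕ B] and [M = A ⊕ B ⊕ D] as internal orthogonal direct sums. *)
Definition orth_sum2 M A B : Prop := orth A B /\ M = sumset A B.
Definition orth_sum3 M A B D : Prop :=
  [/\ orth A B, orth A D, orth B D & M = sumset (sumset A B) D].

End hilbert_geometry.
Arguments separable {R} E.

(* The subspace [A ⊕ B] of the external direct sum. *)
Definition dsum (R : realType) (E F : hilbertType R) (A : set E) (B : set F) :
  set (hsum E F) := [set x | A x.1 /\ B x.2].

Definition hpair (R : realType) (E F : hilbertType R) (x : E) (y : F) :
  hsum E F := (x, y).

Section hardy_operators.
Variables (R : realType) (E : hilbertType R).
Local Notation C := R[i].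

Lemma shift_summable (f : hardy E) :
  (fun n => if n is m.+1 then f m else 0) \in square_summableb.
Proof.
rewrite inE; have [M fM] := coef_summable f; exists M => -[|n].
  by rewrite big_geq//; have := fM 0%N; rewrite big_geq.
by rewrite big_nat_recl//= normr0 expr0n add0r; exact: fM.
Qed.

(* [z f(z)] *)
Definition hshift (f : hardy E) : hardy E := Hardy (shift_summable f).

Lemma const_summable (x : E) :
  (fun n => if n is 0%N then x else 0) \in square_summableb.
Proof.
rewrite inE; exists (`|x| ^+ 2) => -[|n]; first by rewrite big_geq// exprn_ge0.
by rewrite big_nat_recl//= big1 ?addr0// => k _; rewrite normr0 expr0n.
Qed.

Definition hconst (x : E) : hardy E := Hardy (const_summable x).

Definition disc : set C := [set z | `|z| < 1].

(* The value [f(z)], the series being convergent for [z] in the disc. *)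
Definition heval (f : hardy E) (z : C) : E :=
  limn (series (fun n => z ^+ n *: f n)).

End hardy_operators.
Arguments disc R : clear implicits.

Definition H2 (R : realType) : hilbertType R := hardy R[i].

(* [H^2(D^2)] as [H^2(D; H^2(D))]: the outer variable is [z1], so that
   [F i j] is the coefficient of [z1^i z2^j]. *)
Definition H2D2 (R : realType) : hilbertType R := hardy (H2 R).

Section brownian.
Variables (R : realType) (sigma theta : R).
Local Notation C := R[i].

Definition expi : C := cos theta +i* sin theta.

Definition brownian_shift (x : hsum (H2 R) C) : hsum (H2 R) C :=
  hpair (hshift x.1 + sigma%:C *: hconst x.2) (expi * x.2).

(* [hconst f], for [f] in [H^2(D)], is [f_{z2}], constant in [z1]. *)
Definition brownian_shift3 (x : hsum (H2D2 R) (hsum (H2 R) C)) :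
  hsum (H2D2 R) (hsum (H2 R) C) :=
  hpair (hshift x.1 + sigma%:C *: hconst x.2.1) (brownian_shift x.2).

End brownian.

Section inner.
Variable R : realType.
Local Notation C := R[i].

(* [phi] in [H^∞(D)]; values outside of the disc are irrelevant. *)
Definition Hinf (phi : C -> C) : Prop :=
  (forall z, disc R z -> derivable phi z 1) /\
  exists M : C, forall z, disc R z -> `|phi z| <= M.

Definition inner (phi : C -> C) : Prop :=
  Hinf phi /\
  forall f : H2 R, exists2 h : H2 R,
    forall z, disc R z -> heval h z = phi z * heval f z & `|h| = `|f|.

Definition mulH2 (phi : C -> C) : set (H2 R) :=
  [set h | exists f : H2 R, forall z, disc R z -> heval h z = phi z * heval f z].

Definition Kphi (phi : C -> C) : set (H2 R) := orthc (mulH2 phi).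

Definition has_radial_limit (phi : C -> C) (zeta c : C) : Prop :=
  phi (r%:C * zeta) @[r --> (1 : R)^'-] --> c.

Section operator_valued.
Variables E F : hilbertType R.
Implicit Types (Psi : C -> {linear E -> F}) (K : set F).

(* Complex differentiability at [z] in the operator norm. *)
Definition op_derivable Psi (z : C) : Prop :=
  exists2 L : {linear E -> F}, continuous L &
    forall e : C, 0 < e -> \forall h \near (0 : C), forall x,
      `|Psi (z + h) x - Psi z x - h *: L x| <= e * `|h| * `|x|.

(* [Psi] in [H^∞(D; B(E, K))] for a closed subspace [K] of [F]. *)
Definition op_Hinf K Psi : Prop :=
  [/\ forall z, disc R z -> forall x, K (Psi z x),
      exists M : C, forall z, disc R z -> forall x, `|Psi z x| <= M * `|x| &
      forall z, disc R z -> op_derivable Psi z].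

(* [M_Psi] is an isometry from [H^2(D; E)] to [H^2(D; K)]. *)
Definition op_inner K Psi : Prop :=
  op_Hinf K Psi /\
  forall f : hardy E, exists G : hardy F,
    [/\ forall n, K (G n),
        forall z, disc R z -> heval G z = Psi z (heval f z) & `|G| = `|f|].

Definition op_mulH2 Psi : set (hardy F) :=
  [set G | exists f : hardy E,
    forall z, disc R z -> heval G z = Psi z (heval f z)].

End operator_valued.

Definition heval2 (F : H2D2 R) (z1 z2 : C) : C := heval (heval F z1) z2.

(* The functions [(z1, z2) |-> h(z1)]. *)
Definition H2z1 : set (H2D2 R) :=
  [set F | exists h : H2 R, forall z1 z2, disc R z1 -> disc R z2 ->
    heval2 F z1 z2 = heval h z1].

(* [u_{z2} A]: products [u(z2) G(z1, z2)] with [G] in [A]. *)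
Definition mul_z2 (u : C -> C) (A : set (H2D2 R)) : set (H2D2 R) :=
  [set F | exists2 G, A G & forall z1 z2, disc R z1 -> disc R z2 ->
    heval2 F z1 z2 = u z2 * heval2 G z1 z2].

End inner.
Arguments H2z1 R : clear implicits.

(* Main.v *)
Require Import Defs.
From HB Require Import structures.
From mathcomp Require Import all_boot all_order all_algebra sesquilinear.
From mathcomp Require Import ring.
From mathcomp Require Import all_classical all_reals all_analysis.
From mathcomp Require Import complex.

Set Implicit Arguments.
Unset Strict Implicit.
Unset Printing Implicit Defensive.

Import Order.TTheory GRing.Theory Num.Theory.
Import numFieldNormedType.Exports.
Local Open Scope classical_set_scope.
Local Open Scope complex_scope.
Local Open Scope ring_scope.

(** Write [S] for multiplication by [z1], that is [hshift] on [H^2(D^2)], seen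
    as [H^2(D; H^2(D))]. Testing invariance on the vectors [(F, 0)] and
    [(0, (f, a))] shows that [M0] is a closed [S]-invariant subspace and, as
    [sigma] is invertible, that it contains the constant-in-[z1] function [f]
    for every [(f, a)] in [M1] ([dsum1_subspace], [dsum1_shift],
    [dsum1_const]).

    If a closed subspace [N] of [H^2(D)] consists of such constants, then [M0]
    contains [H^2(D; N)], the closed [S]-invariant span of [N]. Projecting all
    coefficients onto [N] therefore maps [M0] into itself, and [M0] is the
    orthogonal sum of [H^2(D; N)] and of its part valued in the complement of
    [N] ([shift_invariant_split]). Take first [N = phi H^2(D)]: its complement
    is [K_phi], and [H^2(D; N)] is [phi_{z2} H^2(D^2)] ([mul_z2_inner]). If
    [M1] also contains [(g, 1)], orthogonal to [phi H^2(D)], so is [g], and the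
    same splitting applies to the remainder with the line spanned by [g], giving
    [g_{z2} H^2_{z1}(D)] ([mul_z2_line]).

    What remains is a closed [S]-invariant subspace of [H^2(D; K)], where [K] is
    [K_phi], respectively the orthogonal complement of [g] in [K_phi]; the
    Beurling-Lax theorem ([beurling_lax]) writes it as [Psi H^2(D; E)] with
    [Psi] inner and valued in [K]. In the presence of [g], the ranges of all the
    [Psi z], and not only that of [Psi 0], are thus orthogonal to [g].

    The proof of Beurling-Lax is the Wold decomposition: [E] is the wandering
    subspace, the complement of [S M] in [M], [Psi z x] is the value at [z] of [x] in
    [H^2(D; K)], and [f |-> sum_n S^n (f n)] is the isometry [M_Psi], whose range
    is [M] because the intersection of the [S^n M] is zero. That [Psi] is bounded
    follows from the isometry by testing on Szego kernels
    ([model_contractive]), and that it is analytic in the operator norm from a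
    Taylor estimate of point evaluations ([heval_taylor]). *)

(** * Sequences in normed spaces *)

Section sequences.
Variable R : realType.
Local Notation C := R[i].
Variable V : normedModType C.
Implicit Types (u v : nat -> V) (l : V).

(** The norm takes its values in the partially ordered field [R[i]]; [rnorm]
    brings it back to [R], where infima and epsilons live. *)
Definition rnorm (x : V) : R := complex.Re `|x|.

Lemma rnormE (x : V) : `|x| = (rnorm x)%:C.
Proof. by rewrite /rnorm RRe_real// normr_real. Qed.

Lemma rnorm_ge0 (x : V) : 0 <= rnorm x.
Proof. by rewrite -lecR -rnormE normr_ge0. Qed.

Lemma seq_cvgP u l : u @ \oo --> l <->
  forall e : R, 0 < e -> exists N, forall n, (N <= n)%N -> rnorm (u n - l) <= e.
Proof.
split=> [/cvgrPdist_lt ul e e0|ul].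
  have ec : 0 < e%:C :> C by rewrite ltcR.
  have [N _ NP] := ul _ ec; exists N => n Nn.
  by rewrite -lecR -rnormE ltW// distrC; exact: NP.
apply/cvgrPdist_lt => _ /gt0_complex[e e0 ->].
have [|N NP] := ul (e / 2); first by rewrite divr_gt0.
exists N => // n /= Nn; rewrite distrC rnormE ltcR (le_lt_trans (NP n Nn))//.
by rewrite ltr_pdivrMr// ltr_pMr// ltr1n.
Qed.

Lemma closed_seq (A : set V) :
  (forall u l, (forall n, A (u n)) -> u @ \oo --> l -> A l) -> closed A.
Proof.
move=> AP x clx.
have h (n : nat) : exists y, A y /\ rnorm (y - x) < n.+1%:R^-1.
  have ec : 0 < (n.+1%:R^-1)%:C :> C by rewrite ltcR invr_gt0.
  have [y [Ay]] := clx _ (nbhsx_ballx x _ ec).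
  by rewrite -ball_normE /ball_/= distrC rnormE ltcR => ?; exists y.
have [u uP] := choice h.
apply: (AP u); first by move=> n; case: (uP n).
apply/seq_cvgP => e e0; exists (Num.truncn e^-1) => n Nn.
have [_ /ltW /le_trans ->//] := uP n.
rewrite -[leRHS]invrK lef_pV2 ?posrE ?invr_gt0//.
by rewrite (le_trans (ltW (truncnS_gt _)))// ler_nat.
Qed.

Lemma closed_lim (A : set V) u l :
  closed A -> (forall n, A (u n)) -> u @ \oo --> l -> A l.
Proof. by move=> Ac Au; apply: closed_cvg => //; apply: nearW. Qed.

Lemma seq_cvg_unique u l l' : u @ \oo --> l -> u @ \oo --> l' -> l = l'.
Proof. by apply: cvg_unique; exact: norm_hausdorff. Qed.

Lemma seq_cvg_le (W : normedModType C) (w : nat -> W) (m : W) u l (M : C) :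
  w @ \oo --> m -> (forall n, `|u n - l| <= M * `|w n - m|) -> u @ \oo --> l.
Proof.
move=> wm uw; apply/cvgrPdist_lt => e e0.
have M0 : 0 < `|M| + 1 by rewrite ltr_wpDl.
have e1 : 0 < e / (`|M| + 1) by rewrite divr_gt0.
move/cvgrPdist_lt : wm => /(_ _ e1); apply: filterS => n.
rewrite ltr_pdivlMr// => wn; rewrite distrC; apply: le_lt_trans wn.
have H := uw n; have X0 : 0 <= M * `|w n - m| by apply: le_trans (normr_ge0 _) H.
apply: le_trans H _; rewrite -[leLHS]ger0_norm//.
by rewrite normrM normr_id mulrC distrC ler_wpM2l// lerDl.
Qed.

End sequences.

(** * Hilbert space geometry and orthogonal projections *)

Section hilbert.
Variable R : realType.
Local Notation C := R[i].
Variable E : hilbertType R.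
Implicit Types (x y a : E) (A B : set E).

Lemma hdotC x y : hdot x y = (hdot y x)^*.
Proof. by rewrite [LHS]hermC mul1r. Qed.

Lemma hdot_sym0 x y : hdot x y = 0 -> hdot y x = 0.
Proof. by move=> xy; rewrite hdotC xy rmorph0. Qed.

Lemma hdotZl (c : C) x y : hdot (c *: x) y = c * hdot x y.
Proof. by rewrite linearZl_LR. Qed.

Lemma hdotZr (c : C) x y : hdot x (c *: y) = c^* * hdot x y.
Proof. by rewrite linearZr_LR. Qed.

Lemma hnormD x y : `|x + y| ^+ 2 = `|x| ^+ 2 + `|y| ^+ 2 + (hdot x y + hdot y x).
Proof. by rewrite -!hdotE [hdot y x]hdotC dnormD. Qed.

Lemma pythagoras x y : hdot x y = 0 -> `|x + y| ^+ 2 = `|x| ^+ 2 + `|y| ^+ 2.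
Proof. by move=> xy; rewrite hnormD [hdot y x]hdotC xy rmorph0 !addr0. Qed.

Lemma parallelogram x y :
  `|x + y| ^+ 2 + `|x - y| ^+ 2 = (`|x| ^+ 2 + `|y| ^+ 2) *+ 2.
Proof.
by rewrite [`|x - y|^+2]hnormD hnormD linearNl linearNr /= normrN; ring.
Qed.

Lemma seq_complete (u : nat -> E) :
  (forall e : R, 0 < e -> exists N, forall m n, (N <= m)%N -> (N <= n)%N ->
     rnorm (u m - u n) <= e) -> exists l : E, u @ \oo --> l.
Proof.
move=> uC; suff /cvg_ex : cvg (u @ \oo) by [].
apply: cauchy_cvg; apply/cauchy_ballP => _ /gt0_complex[e e0 ->].
have [|N NP] := uC (e / 2); first by rewrite divr_gt0.
exists ([set u n | n in [set n | (N <= n)%N]],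
        [set u n | n in [set n | (N <= n)%N]]).
  by split; exists N => // n Nn; exists n.
move=> [_ _] /= [[m Nm <-] [n Nn <-]]; rewrite -ball_normE /= rnormE ltcR.
apply: le_lt_trans (NP _ _ Nm Nn) _.
by rewrite ltr_pdivrMr// ltr_pMr// ltr1n.
Qed.

Lemma subspD A x y : closed_subspace A -> A x -> A y -> A (x + y).
Proof. by case=> _ _ AP Ax Ay; rewrite -[x]scale1r; exact: AP. Qed.

Lemma subspZ A (c : C) x : closed_subspace A -> A x -> A (c *: x).
Proof. by case=> _ A0 AP Ax; rewrite -[c *: x]addr0; exact: AP. Qed.

Lemma subspN A x : closed_subspace A -> A x -> A (- x).
Proof. by move=> Ac Ax; rewrite -scaleN1r; exact: subspZ. Qed.

Lemma subspB A x y : closed_subspace A -> A x -> A y -> A (x - y).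
Proof. by move=> Ac Ax Ay; apply: subspD => //; exact: subspN. Qed.

Lemma subsp_sum A (u : nat -> E) n : closed_subspace A ->
  (forall k, A (u k)) -> A (\sum_(0 <= k < n) u k).
Proof.
move=> Ac Au; elim: n => [|n IH]; first by rewrite big_geq//; case: Ac.
by rewrite big_nat_recr//=; exact: subspD.
Qed.

(** Existence of orthogonal projections: a minimizing sequence is Cauchy by
    the parallelogram law, and the residual at the minimum is orthogonal. *)
Lemma projection_ex A x : closed_subspace A ->
  exists2 y, A y & forall a, A a -> hdot (x - y) a = 0.
Proof.
move=> Ac; have [Acl A0 AP] := Ac.
(* [d] is the squared distance from [x] to [A], [u] a minimizing sequence *)
pose D := [set rnorm (x - a) ^+ 2 | a in A].
have infD : has_inf D.
  split; first by exists (rnorm (x - 0) ^+ 2); exists 0.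
  by exists 0 => _ [a _ <-]; rewrite exprn_ge0 ?rnorm_ge0.
pose d := inf D.
have dle a : A a -> d <= rnorm (x - a) ^+ 2.
  by move=> Aa; apply: ge_inf; [case: infD|exists a].
have h (n : nat) : exists a, A a /\ rnorm (x - a) ^+ 2 < d + n.+1%:R^-1.
  have n0 : 0 < n.+1%:R^-1 :> R by rewrite invr_gt0.
  by have [_ [a Aa <-] ?] := inf_adherent n0 infD; exists a.
have [u uP] := choice h.
have par m n : rnorm (u m - u n) ^+ 2 <= (m.+1%:R^-1 + n.+1%:R^-1) *+ 2.
  pose mid := 2^-1 *: (u m + u n).
  have := parallelogram (x - u m) (x - u n).
  have -> : x - u m - (x - u n) = u n - u m.
    by rewrite opprB addrC addrA addrNK.
  rewrite [`|u n - _|]distrC.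
  have -> : x - u m + (x - u n) = 2 *: (x - mid).
    rewrite /mid scalerBr scalerA mulfV ?pnatr_eq0// scale1r scaler_nat mulr2n.
    by rewrite opprD addrACA.
  rewrite normrZ normr_nat !rnormE.
  rewrite (_ : 2 = 2%:R%:C); last by rewrite rmorph_nat.
  rewrite -!rmorphXn/= -rmorphM/= -rmorphXn /= -!rmorphD /= -rmorphMn/=.
  move=> /complexI.
  have Amid : A mid.
    by apply: subspZ => //; apply: subspD => //; [case: (uP m)|case: (uP n)].
  have := dle _ Amid; have [_ ] := uP m; have [_] := uP n.
  set a := rnorm (u m - u n) ^+ 2; set b := rnorm (x - u m) ^+ 2.
  set c := rnorm (x - u n) ^+ 2; rewrite exprMn.
  set f := rnorm _ ^+ 2 => cd bd df E1.
  have -> : a = (b + c) *+ 2 - 2 ^+ 2 * f by rewrite -E1 addrC addKr.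
  have : (b + c) *+ 2 <= (m.+1%:R^-1 + n.+1%:R^-1 + d *+ 2) *+ 2.
    by rewrite lerMn2r/=; apply: le_trans (lerD (ltW bd) (ltW cd)) _;
      rewrite mulr2n addrACA addrC.
  have : 2 ^+ 2 * d <= 2 ^+ 2 * f by rewrite ler_wpM2l.
  move=> H1 H2; apply: le_trans (lerB H2 H1) _.
  by rewrite (_ : _ - _ = (m.+1%:R^-1 + n.+1%:R^-1) *+ 2)//; ring.
have [y uy] : exists y : E, u @ \oo --> y.
  apply: seq_complete => e e0.
  have e2 : 0 < e ^+ 2 / 4 by rewrite divr_gt0// exprn_gt0.
  exists (Num.truncn (e ^+ 2 / 4)^-1) => m n Nm Nn.
  rewrite -(@ler_pXn2r _ 2)// ?nnegrE ?rnorm_ge0 ?(ltW e0)//.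
  apply: le_trans (par m n) _.
  have inv k : (Num.truncn (e ^+ 2 / 4)^-1 <= k)%N -> k.+1%:R^-1 <= e ^+ 2 / 4.
    move=> Nk; rewrite -[leRHS]invrK lef_pV2 ?posrE ?invr_gt0//.
    by rewrite (le_trans (ltW (truncnS_gt _)))// ler_nat.
  apply: (@le_trans _ _ ((e ^+ 2 / 4 + e ^+ 2 / 4) *+ 2)).
    by rewrite lerMn2r/=; apply: lerD; exact: inv.
  by rewrite le_eqVlt; apply/orP; left; apply/eqP; field.
have Ay : A y by apply: (closed_lim Acl _ uy) => n; case: (uP n).
have yd : rnorm (x - y) ^+ 2 <= d.
  have := uy; rewrite seq_cvgP => uy'.
  have h2 e : 0 < e -> rnorm (x - y) <= Num.sqrt (d + e) + e.
    move=> e0; have [N NP] := uy' e e0.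
    pose n := maxn N (Num.truncn e^-1).
    have un : rnorm (u n - y) <= e by apply: NP; rewrite leq_maxl.
    have xn : rnorm (x - u n) <= Num.sqrt (d + e).
      rewrite -[leLHS]ger0_norm ?rnorm_ge0// -sqrtr_sqr ler_wsqrtr//.
      have [_ /ltW /le_trans->//] := uP n; rewrite lerD2l.
      rewrite -[leRHS]invrK lef_pV2 ?posrE ?invr_gt0//.
      by rewrite (le_trans (ltW (truncnS_gt _)))// ler_nat ltnS leq_maxr.
    apply: le_trans _ (lerD xn un).
    by rewrite -lecR rmorphD /= -!rnormE (le_trans _ (ler_normD _ _))// addrA addrNK.
  rewrite leNgt; apply/negP => dlt.
  have d0 : 0 <= d by apply: lb_le_inf; [case: infD|move=> _ [a _ <-]; rewrite exprn_ge0 ?rnorm_ge0].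
  pose r := rnorm (x - y); have r0 : 0 <= r by exact: rnorm_ge0.
  have sr : Num.sqrt d < r.
    by rewrite -[r]ger0_norm// -sqrtr_sqr ltr_sqrt// (le_lt_trans d0).
  pose g := (r - Num.sqrt d) / 2.
  have g0 : 0 < g by rewrite divr_gt0// subr_gt0.
  pose e := Num.min (g / 2) ((g / 2) ^+ 2).
  have g20 : 0 < g / 2 by rewrite divr_gt0.
  have e0 : 0 < e by rewrite lt_min g20 exprn_gt0.
  have := h2 e e0; apply/negP; rewrite -ltNge -/r.
  have : Num.sqrt (d + e) <= Num.sqrt d + g / 2.
    rewrite -(@ler_pXn2r _ 2)// ?nnegrE ?addr_ge0 ?sqrtr_ge0 ?(ltW g20)//.
    rewrite sqr_sqrtr ?addr_ge0 ?(ltW e0)// sqrrD sqr_sqrtr//.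
    rewrite -addrA lerD2l (le_trans (_ : e <= (g / 2) ^+ 2)) ?ge_min ?lexx ?orbT//.
    by rewrite lerDr mulrn_wge0// mulr_ge0 ?sqrtr_ge0 ?ltW.
  move=> H; apply: (@le_lt_trans _ _ (Num.sqrt d + g / 2 + g / 2)).
    by apply: lerD => //; rewrite ge_min lexx.
  rewrite -addrA -splitr -ltrBrDl /g ltr_pdivrMr// ltr_pMr ?ltr1n//.
  by rewrite subr_gt0.
(* compare [y] with [y + t a] for the optimal [t] *)
exists y => // a Aa.
have [->|a0] := eqVneq a 0; first by rewrite linear0r.
pose t := hdot (x - y) a / hdot a a.
have aa0 : 0 < hdot a a by rewrite dnorm_gt0.
have : `|x - y| ^+ 2 <= `|x - y - t *: a| ^+ 2.
  rewrite !rnormE -!rmorphXn /= lecR; apply: le_trans yd _.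
  by rewrite -addrA -opprD; apply: dle; apply: subspD => //; exact: subspZ.
rewrite -hdotE -[leRHS]hdotE [leRHS]dnormB dnormZ hdotZr.
have ac : (hdot a a)^* = hdot a a by rewrite conj_Creal// gtr0_real.
rewrite /t normrM normfV (gtr0_norm aa0) !rmorphM /= fmorphV /= ac fmorphV /= ac.
rewrite conjCK exprMn exprVn normCK.
set h1 := hdot (x - y) a; set b := hdot a a.
have b0 : b != 0 by rewrite gt_eqF.
rewrite -subr_ge0 (_ : _ - _ = - (h1 * h1^* / b)); last by field.
rewrite oppr_ge0 => H; apply/eqP; rewrite -normr_eq0 -sqrf_eq0 normCK.
rewrite eq_le; apply/andP; split; last by rewrite -normCK exprn_ge0.
by move: H; rewrite pmulr_lle0 ?invr_gt0.
Qed.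

End hilbert.

(** * Power series with vector coefficients *)

Section bundling.
Variables (R : realType) (U V : lmodType R[i]) (f : U -> V).
Hypothesis fL : forall c x y, f (c *: x + y) = c *: f x + f y.

Let lin_mixin := GRing.isLinear.Build R[i] U V *:%R f fL.
Definition mk_linear : {linear U -> V} := HB.pack f lin_mixin.
Lemma mk_linearE x : mk_linear x = f x. Proof. by []. Qed.
End bundling.

Section weighted_sums.
Variables (R : realType).
Local Notation C := R[i].
Implicit Types (a : nat -> C) (z : C).

Definition abs_summable a (M : C) := forall n, \sum_(0 <= k < n) `|a k| <= M.

(** Summing the recursion bounds the sum [D] of the solution by
    [d 0 + r D + B]. Applied repeatedly, this controls the geometric series and
    its derivatives. *)
Lemma recursion_sum_le (r : C) (d b : nat -> C) (B : C) :
  0 <= r < 1 -> 0 <= B -> 0 <= d 0%N ->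
  (forall n, d n.+1 = r * d n + b n) ->
  (forall n, \sum_(0 <= k < n) b k <= B) ->
  forall n, \sum_(0 <= k < n) d k <= (d 0%N + B) / (1 - r).
Proof.
move=> /andP[r0 r1] B0 d0 dS bB; have r1' : 0 < 1 - r by rewrite subr_gt0.
elim=> [|n IH]; first by rewrite big_geq// divr_ge0 ?(ltW r1')// addr_ge0.
rewrite big_nat_recl//=; under eq_bigr do rewrite dS.
rewrite big_split /= -mulr_sumr.
apply: (@le_trans _ _ (d 0%N + (r * ((d 0%N + B) / (1 - r)) + B))).
  by rewrite lerD2l lerD// ler_wpM2l.
rewrite le_eqVlt; apply/orP; left; apply/eqP; field.
by rewrite gt_eqF.
Qed.

Lemma geometric_abs_summable z : `|z| < 1 ->
  abs_summable (fun n => z ^+ n) (1 - `|z|)^-1.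
Proof.
move=> z1 n; have := @recursion_sum_le `|z| (fun n => `|z| ^+ n) (fun=> 0) 0.
rewrite expr0 addr0 div1r => H.
under eq_bigr do rewrite normrX.
apply: H => //; first by rewrite normr_ge0.
  by move=> k; rewrite exprS addr0.
by move=> k; rewrite big1.
Qed.

Variable E : hilbertType R.
Implicit Types (f g : hardy E).

(** Evaluation at a point is the case [a n = z ^+ n] and its derivative the case
    [a n = n z^(n-1)]; both, and the Taylor remainder, are controlled at once
    by the absolute sum of the weights. *)
Definition wsum a f : E := limn (series (fun n => a n *: f n)).

Lemma wsum_cvg a M f : abs_summable a M ->
  series (fun n => a n *: f n) @ \oo --> wsum a f.
Proof.
move=> aM; have ac : cvgn (series (fun n => `|a n|)).
  by apply: (@is_cvg_seriesC _ _ M) => n; under eq_bigr do rewrite normr_id.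
apply/cauchy_cvgP/cauchy_seriesP => e e0.
have f1 : 0 < `|f| + 1 by rewrite ltr_wpDl.
have e1 : 0 < e / (`|f| + 1) by rewrite divr_gt0.
move/cauchy_cvgP/cauchy_seriesP : ac => /(_ _ e1).
apply: filterS => -[m n] /=; rewrite ger0_norm ?sumr_ge0// ltr_pdivlMr//.
apply: le_lt_trans; apply: le_trans (ler_norm_sum _ _ _) _.
rewrite mulr_suml; apply: ler_sum => k _; rewrite normrZ ler_wpM2l//.
by rewrite (le_trans (coef_norm_le _ _))// lerDl.
Qed.

Lemma wsumE a f x : series (fun n => a n *: f n) @ \oo --> x -> wsum a f = x.
Proof. by apply: cvg_lim; exact: norm_hausdorff. Qed.

Lemma wsum_linear a M : abs_summable a M ->
  forall (c : C) f g, wsum a (c *: f + g) = c *: wsum a f + wsum a g.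
Proof.
move=> aM c f g; apply: wsumE.
rewrite (_ : series _ = (fun n => c *: series (fun n => a n *: f n) n +
                                  series (fun n => a n *: g n) n)).
  by apply: cvgD; [apply: cvgZr|]; apply: wsum_cvg aM.
apply/funext => n; rewrite /series /= scaler_sumr -big_split /=.
by apply: eq_bigr => k _; rewrite scalerDr !scalerA [c * _]mulrC.
Qed.

Lemma wsum_norm_le a M f : abs_summable a M -> `|wsum a f| <= M * `|f|.
Proof.
move=> aM; have h : `|series (fun n => a n *: f n) n| @[n --> \oo] --> `|wsum a f|.
  by apply: cvg_norm; exact: wsum_cvg aM.
apply: (cvgC_le h).
apply: nearW => n; apply: le_trans (ler_norm_sum _ _ _) _.
apply: (@le_trans _ _ ((\sum_(0 <= k < n) `|a k|) * `|f|)).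
  rewrite mulr_suml; apply: ler_sum => k _; rewrite normrZ ler_wpM2l//.
  exact: coef_norm_le.
by rewrite ler_wpM2r.
Qed.

End weighted_sums.

Section monomials.
Variables (R : realType) (E : hilbertType R).
Local Notation C := R[i].
Implicit Types (f g : hardy E) (x : E) (z : C).

Lemma hcoefB f g k : (f - g) k = f k - g k. Proof. by []. Qed.

Lemma hcoefD f g k : (f + g) k = f k + g k. Proof. by []. Qed.

Lemma hcoefZ (c : C) f k : (c *: f) k = c *: f k. Proof. by []. Qed.

Definition hmono n x : hardy E := iter n (@hshift R E) (hconst x).

Lemma hmonoE n x k : hmono n x k = if k == n then x else 0.
Proof. by elim: n k => [|n IH] [|k] //=; rewrite IH. Qed.

(** Taylor polynomials. *)
Definition hpart f n : hardy E := \sum_(0 <= k < n) hmono k (f k).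

Lemma coef_sum (F : nat -> hardy E) n k :
  (\sum_(0 <= i < n) F i) k = \sum_(0 <= i < n) F i k.
Proof.
elim: n => [|n IH]; first by rewrite !big_geq.
by rewrite !big_nat_recr//= -IH.
Qed.

Lemma hpartE f n k : hpart f n k = if (k < n)%N then f k else 0.
Proof.
rewrite /hpart coef_sum; elim: n => [|n IH]; first by rewrite big_geq.
rewrite big_nat_recr//= IH hmonoE [(k < n.+1)%N]ltnS [(k <= n)%N]leq_eqVlt.
by have [->|] := eqVneq k n; rewrite /= ?ltnn ?add0r ?addr0.
Qed.

(** The squared error is the tail of the series of squared coefficient norms. *)
Lemma hpart_cvg f : hpart f @ \oo --> f.
Proof.
pose s := series (fun k => hdot (f k) (f k)).
have sE n : s n = \sum_(0 <= k < n) `|f k| ^+ 2.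
  by rewrite /s /series /=; apply: eq_bigr => k _; rewrite hdotE.
have bound n : `|hpart f n - f| ^+ 2 <= `|s n - hardy_dot f f|.
  have [h hE ->] : exists2 h : hardy E, (forall k, h k = hpart f n k - f k) &
      hpart f n - f = h by exists (hpart f n - f).
  have sf : s n <= hardy_dot f f by rewrite sE partial_sum_le.
  rewrite distrC ger0_norm ?subr_ge0//.
  rewrite -[leLHS]hdotE.
  apply: (cvgC_le (@hardy_dot_cvg _ _ h h)).
  exists n => // m /= nm; rewrite lerBrDr.
  apply: le_trans (partial_sum_le f m).
  rewrite sE (big_cat_nat (leq0n n) nm) /= big1_seq ?add0r.
    rewrite [leRHS](big_cat_nat (leq0n n) nm) /= [leLHS]addrC lerD2l.
    rewrite !big_nat; apply: ler_sum => k /andP[nk _].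
    by rewrite hdotE hE hpartE ltnNge nk sub0r normrN.
  move=> k /=; rewrite mem_index_iota => /andP[_ kn].
  by rewrite hE hpartE kn subrr linear0l.
have sc : s @ \oo --> hardy_dot f f by exact: hardy_dot_cvg.
apply/cvgrPdist_lt => e e0; have e2 : 0 < e ^+ 2 by rewrite exprn_gt0.
move/cvgrPdist_lt : sc => /(_ _ e2); apply: filterS => n sn.
rewrite distrC -(@ltr_pXn2r _ 2)// ?nnegrE ?(ltW e0)//.
by apply: le_lt_trans (bound n) _; rewrite distrC.
Qed.

(** Linear combinations of monomials are dense, so bounded linear maps are
    determined by their values on monomials. *)
Lemma eq_on_monomials (F : hilbertType R) (A B : hardy E -> F) (M N : C) :
  (forall (c : C) f g, A (c *: f + g) = c *: A f + A g) ->
  (forall (c : C) f g, B (c *: f + g) = c *: B f + B g) ->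
  (forall f, `|A f| <= M * `|f|) -> (forall f, `|B f| <= N * `|f|) ->
  (forall n x, A (hmono n x) = B (hmono n x)) -> forall f, A f = B f.
Proof.
move=> AL BL AM BN AB f.
have cv (D : hardy E -> F) K : (forall (c : C) f g, D (c *: f + g) = c *: D f + D g) ->
    (forall f, `|D f| <= K * `|f|) -> (fun n => D (hpart f n)) @ \oo --> D f.
  move=> DL DK; apply: (@seq_cvg_le _ _ _ (hpart f) f _ _ K) => [|n].
    exact: hpart_cvg.
  by rewrite -!(mk_linearE DL) -linearB.
apply: seq_cvg_unique (cv _ _ AL AM) _.
suff -> : (fun n => A (hpart f n)) = (fun n => B (hpart f n)) by exact: cv BL BN.
apply/funext => n; rewrite -(mk_linearE AL) -(mk_linearE BL) !linear_sum /=.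
by apply: eq_bigr => k _.
Qed.

Lemma cvg_eventually_cst (V : normedModType C) (u : nat -> V) l N :
  (forall n, (N <= n)%N -> u n = l) -> u @ \oo --> l.
Proof. by move=> ul; apply: cvg_near_cst; exists N. Qed.

Lemma wsum_hmono (a : nat -> C) n x : wsum a (hmono n x) = a n *: x.
Proof.
apply: wsumE; apply: (@cvg_eventually_cst _ _ _ n.+1) => m nm.
rewrite /series /= (bigD1_seq n) ?iota_uniq ?mem_index_iota//= hmonoE eqxx.
by rewrite big1 ?addr0// => k /negPf kn; rewrite hmonoE kn scaler0.
Qed.

Lemma hdot_hmono n x g : hdot (hmono n x) g = hdot x (g n).
Proof.
apply: hardy_dotE; apply: (@cvg_eventually_cst _ _ _ n.+1) => m nm.
rewrite /series /= (bigD1_seq n) ?iota_uniq ?mem_index_iota//= hmonoE eqxx.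
by rewrite big1 ?addr0// => k /negPf kn; rewrite hmonoE kn linear0l.
Qed.

Lemma hmonoB n (x y : E) :
  hmono n x - hmono n y = hmono n (x - y).
Proof.
by apply: hardyP => k; rewrite hcoefB !hmonoE; case: ifP; rewrite ?subr0.
Qed.

Lemma hmono_norm n (x : E) : `|hmono n x| = `|x|.
Proof.
by apply/eqP; rewrite -(@eqrXn2 _ 2)// -!hdotE hdot_hmono hmonoE eqxx.
Qed.

Lemma heval_linear z : disc R z ->
  forall (c : C) f g, heval (c *: f + g) z = c *: heval f z + heval g z.
Proof. by move=> z1; apply: wsum_linear; exact: geometric_abs_summable. Qed.

Lemma heval_le z f : disc R z -> `|heval f z| <= (1 - `|z|)^-1 * `|f|.
Proof. by move=> z1; apply: wsum_norm_le; exact: geometric_abs_summable. Qed.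

Lemma heval_hmono n x z : heval (hmono n x) z = z ^+ n *: x.
Proof. exact: wsum_hmono. Qed.

Lemma heval_const x z : heval (hconst x) z = x.
Proof. by rewrite (heval_hmono 0) scale1r. Qed.

Lemma heval_B z f g : disc R z -> heval (f - g) z = heval f z - heval g z.
Proof. by move=> z1; rewrite -!(mk_linearE (heval_linear z1)) linearB. Qed.

Lemma heval_Z z c f : disc R z -> heval (c *: f) z = c *: heval f z.
Proof. by move=> z1; rewrite -!(mk_linearE (heval_linear z1)) linearZ. Qed.

Lemma hshift_linear (c : C) f g :
  hshift (c *: f + g) = c *: hshift f + hshift g.
Proof. by apply: hardyP => -[|k] //; rewrite coefZD /= scaler0 addr0. Qed.

Lemma hshift_dot f g : hdot (hshift f) (hshift g) = hdot f g.
Proof.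
apply: hardy_dotE; rewrite -cvg_shiftS.
rewrite (_ : (fun n => _) = series (fun k => hdot (f k) (g k))).
  exact: hardy_dot_cvg.
by apply/funext => n; rewrite /series /= big_nat_recl//= linear0l add0r.
Qed.

Lemma hshift_norm f : `|hshift f| = `|f|.
Proof.
by apply/eqP; rewrite -(@eqrXn2 _ 2)// -!hdotE hshift_dot.
Qed.

Lemma heval_shift f z : disc R z -> heval (hshift f) z = z *: heval f z.
Proof.
move=> z1.
apply: (@eq_on_monomials E (fun f => heval (hshift f) z)
          (fun f => z *: heval f z) (1 - `|z|)^-1 (`|z| * (1 - `|z|)^-1)).
- by move=> c x y; rewrite hshift_linear heval_linear.
- by move=> c x y; rewrite heval_linear// scalerDr !scalerA [z * c]mulrC.
- by move=> g; rewrite -hshift_norm heval_le.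
- by move=> g; rewrite normrZ -mulrA ler_wpM2l ?heval_le.
- by move=> n x; rewrite (heval_hmono n.+1) heval_hmono scalerA exprS.
Qed.

Lemma heval0 f : heval f 0 = f 0%N.
Proof.
have d0 : disc R 0 by rewrite /disc /= normr0 ltr01.
apply: (@eq_on_monomials E (fun f => heval f 0)
          (fun f => f 0%N) (1 - `|0|)^-1 1) => //.
- by move=> c x y; rewrite heval_linear.
- by move=> g; exact: heval_le.
- by move=> g; rewrite mul1r coef_norm_le.
- by move=> [|n] x; rewrite heval_hmono hmonoE ?scale1r// expr0n/= scale0r.
Qed.

Lemma unshift_summable f : (fun n => f n.+1) \in square_summableb.
Proof.
rewrite inE; have [M fM] := coef_summable f; exists M => n.
have := fM n.+1; rewrite big_nat_recl//=; apply: le_trans.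
by rewrite lerDr exprn_ge0.
Qed.

Definition unshift f : hardy E := Hardy (unshift_summable f).

Lemma unshiftK f : f = hconst (f 0%N) + hshift (unshift f).
Proof.
by apply: hardyP => -[|k]; rewrite hcoefD /= ?addr0 ?add0r.
Qed.

(** A power series vanishing on the disc has zero coefficients: divide by [z]
    and let [z] tend to 0, coefficient after coefficient. *)
Lemma heval_inj f g : (forall z, disc R z -> heval f z = heval g z) -> f = g.
Proof.
move=> fg; suff h n : forall h : hardy E,
    (forall z, disc R z -> heval h z = 0) -> h n = 0.
  apply: hardyP => n; apply/eqP; rewrite -subr_eq0 -hcoefB; apply/eqP/h => z z1.
  by rewrite heval_B// fg// subrr.
elim: n => [|n IH] h h0.
  by rewrite -heval0 h0// /disc /= normr0 ltr01.
have hE : h = hshift (unshift h).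
  rewrite {1}(unshiftK h) -heval0 h0 ?/disc/= ?normr0 ?ltr01//.
  by apply: hardyP => -[|k]; rewrite hcoefD /= ?add0r.
rewrite -[h n.+1]/(unshift h n); set u := unshift h.
have u0 z : disc R z -> z != 0 -> heval u z = 0.
  move=> z1 z0; have := h0 z z1; rewrite hE heval_shift// => /eqP.
  by rewrite scaler_eq0 (negPf z0) => /eqP.
apply: IH => z z1; have [->|] := eqVneq z 0; last exact: u0.
rewrite heval0.
have b z' : 0 < z' -> z' <= 2^-1 -> `|u 0%N| <= 2 * `|unshift u| * z'.
  move=> z'0 z'1; have dz : disc R z'.
    by rewrite /disc /= gtr0_norm// (le_lt_trans z'1)// invf_lt1 ?ltr1n.
  have := u0 _ dz (lt0r_neq0 z'0); rewrite {1}(unshiftK u).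
  rewrite -[hconst _]scale1r heval_linear// scale1r heval_const heval_shift//.
  move=> /eqP; rewrite addr_eq0 => /eqP ->; rewrite normrN normrZ gtr0_norm//.
  rewrite mulrC ler_wpM2r ?(ltW z'0)//; apply: le_trans (heval_le _ dz) _.
  rewrite ler_wpM2r// gtr0_norm// invf_ple ?posrE ?subr_gt0 ?ltr0n//.
    by rewrite lerBrDl -lerBrDr (le_trans z'1)// lerBrDr [leRHS]splitr div1r.
  by rewrite (le_lt_trans z'1)// invf_lt1 ?ltr1n.
have [//|] := eqVneq (u 0%N) 0; rewrite -normr_gt0 => a0.
pose K := 2 * `|unshift u|.
have K0 : 0 <= K by rewrite mulr_ge0.
have Ka : 0 < 2 * (K + `|u 0%N|) by rewrite mulr_gt0// ltr_wpDl.
(* at [z = a / (2 (K + a))], with [a = |u 0|], the bound [a <= K z] fails *)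
have := b (`|u 0%N| / (2 * (K + `|u 0%N|))) (divr_gt0 a0 Ka).
rewrite ler_pdivrMr// mulKf ?pnatr_eq0// lerDr => /(_ K0).
rewrite -/K mulrA ler_pdivlMr// mulrC ler_pM2r// lt_geF//.
apply: (@le_lt_trans _ _ (2 * K)); first by rewrite ler_peMl// ler1n.
by rewrite ltr_pM2l// ltrDl.
Qed.
End monomials.

(** * Closed subspaces *)

Section isometry.
Variables (R : realType) (E F : hilbertType R).
Local Notation C := R[i].

(** A Cauchy sequence of images pulls back to a Cauchy sequence. *)
Lemma isometry_closed (T : E -> F) (A : set E) :
  (forall (c : C) x y, T (c *: x + y) = c *: T x + T y) ->
  (forall x, `|T x| = `|x|) -> closed_subspace A -> closed_subspace (T @` A).
Proof.
move=> TL TN [Ac A0 AP]; split.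
- apply: closed_seq => u l Au ul.
  have /choice[v vP] : forall n, exists x, A x /\ T x = u n.
    by move=> n; have [x Ax <-] := Au n; exists x.
  have rnormT x y : rnorm (x - y) = rnorm (T x - T y).
    by rewrite -!(mk_linearE TL) -linearB /rnorm TN.
  have [x vx] : exists x : E, v @ \oo --> x.
    apply: seq_complete => e e0; move/seq_cvgP : ul => /(_ (e / 2)).
    rewrite divr_gt0// => /(_ isT)[N NP]; exists N => m n Nm Nn.
    rewrite rnormT; have [_ ->] := vP m; have [_ ->] := vP n.
    rewrite [e]splitr; apply: le_trans (lerD (NP m Nm) (NP n Nn)).
    rewrite -lecR rmorphD /= -!rnormE; apply: le_trans (ler_distD l _ _) _.
    by rewrite [`|l - _|]distrC.
  exists x; first by apply: (closed_lim Ac _ vx) => n; case: (vP n).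
  apply: (seq_cvg_unique _ ul); apply: (@seq_cvg_le _ _ _ v x _ _ 1) => // n.
  by have [_ <-] := vP n; rewrite mul1r -!(mk_linearE TL) -linearB TN.
- by exists 0 => //; rewrite -(mk_linearE TL) linear0.
- by move=> c _ _ [x Ax <-] [y Ay <-]; exists (c *: x + y); [exact: AP|exact: TL].
Qed.

Lemma subspace_setT : closed_subspace [set: E].
Proof. by split => //; exact: closedT. Qed.

Lemma subspaceI (A B : set E) : closed_subspace A -> closed_subspace B ->
  closed_subspace (A `&` B).
Proof.
move=> [Ac A0 AP] [Bc B0 BP]; split; [exact: closedI|by []|].
by move=> c x y [Ax Bx] [Ay By]; split; [exact: AP|exact: BP].
Qed.

Lemma preimage_subspace (T : E -> F) (A : set F) (M : C) :
  (forall (c : C) x y, T (c *: x + y) = c *: T x + T y) ->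
  (forall x, `|T x| <= M * `|x|) -> closed_subspace A ->
  closed_subspace (T @^-1` A).
Proof.
move=> TL TM [Ac A0 AP]; split.
- apply: closed_seq => u l Au ul; apply: (closed_lim Ac Au).
  apply: (@seq_cvg_le _ _ _ u l _ _ M) => // n.
  by rewrite -!(mk_linearE TL) -linearB TM.
- by rewrite /preimage /= -(mk_linearE TL) linear0.
- by move=> c x y Ax Ay; rewrite /preimage /= TL; exact: AP.
Qed.

End isometry.

Section orthogonal.
Variables (R : realType) (E : hilbertType R).
Local Notation C := R[i].
Implicit Types (x y : E) (A B : set E).

(** The complement is an intersection of kernels of bounded functionals. *)
Lemma orthc_subspace A : closed_subspace (orthc A).
Proof.
have H y : closed_subspace (hdot^~ y @^-1` [set (0 : C)]).
  apply: (@preimage_subspace _ _ _ _ _ `|y|) => [c u v|u|].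
  - by rewrite linearPl.
  - by rewrite mulrC hdot_norm_le.
  - split=> [||c _ _ -> ->]; last by rewrite scaler0 addr0.
      by apply: closed_seq => u l u0 ul; apply: (seq_cvg_unique ul);
        apply: cvg_near_cst; apply: nearW => n; exact: u0.
    by [].
split.
- rewrite (_ : orthc A = \bigcap_(y in A) (hdot^~ y @^-1` [set 0]))//.
  by apply: closed_bigI => y _; case: (H y).
- by move=> y _; rewrite linear0l.
- by move=> c x z Ax Az y Ay; case: (H y) => _ _; apply; [exact: Ax|exact: Az].
Qed.

Definition line x := [set a *: x | a in [set: C]].

(** For [x = 0] the quotient is [0], which is still a coordinate on the zero
    line. *)
Definition line_coord x y : C := hdot y x / hdot x x.

Lemma line_coordE x y : line x y -> y = line_coord x y *: x.
Proof.
case=> a _ <-; rewrite /line_coord hdotZl.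
have [->|x0] := eqVneq x 0; first by rewrite !scaler0.
by rewrite mulfK// gt_eqF// dnorm_gt0.
Qed.

Lemma line_coord_linear x (c : C) y z :
  line_coord x (c *: y + z) = c * line_coord x y + line_coord x z.
Proof. by rewrite /line_coord linearPl /= mulrDl mulrA. Qed.

Lemma line_coord_le x y :
  `|line_coord x y| <= (`|x| / `|hdot x x|) * `|y|.
Proof.
rewrite normrM normfV mulrAC ler_wpM2r ?invr_ge0// mulrC.
exact: hdot_norm_le.
Qed.

(** The line is the kernel of a bounded map, [id] minus the projection. *)
Lemma line_subspace x : closed_subspace (line x).
Proof.
pose T y := y - line_coord x y *: x.
have -> : line x = T @^-1` [set 0].
  apply/seteqP; split => [y /line_coordE|y] /=; rewrite /T.
    by move=> /eqP; rewrite -subr_eq0 => /eqP.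
  by move=> /eqP; rewrite subr_eq0 => /eqP ->; exists (line_coord x y).
apply: (@preimage_subspace _ _ _ _ _ (1 + (`|x| / `|hdot x x|) * `|x|)).
- by move=> c y z; rewrite /T line_coord_linear scalerBr scalerDl !scalerA
    opprD addrACA.
- move=> y; apply: le_trans (ler_normB _ _) _.
  rewrite mulrDl mul1r lerD2l normrZ mulrAC ler_wpM2r//.
  exact: line_coord_le.
- split=> [||c _ _ -> ->]; last by rewrite scaler0 addr0.
    by apply: closed_seq => u l u0 ul; apply: (seq_cvg_unique ul);
        apply: cvg_near_cst; apply: nearW => n; exact: u0.
  by [].
Qed.

End orthogonal.

(** * Functions with coefficients in a subspace *)

Section coefficientwise.
Variables (R : realType) (E F : hilbertType R).
Local Notation C := R[i].

Section hmap.
Variables (A : E -> F) (M : C).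
Hypothesis AM : forall x, `|A x| <= M * `|x|.

Let AM_norm x : `|A x| <= `|M| * `|x|.
Proof.
have H := AM x; have M0 : 0 <= M * `|x| by apply: le_trans H.
by rewrite -[`|x|]normr_id -normrM ger0_norm.
Qed.

Lemma hmap_summable (f : hardy E) : (fun n => A (f n)) \in square_summableb.
Proof.
rewrite inE; have [K fK] := coef_summable f; exists (`|M| ^+ 2 * K) => n.
apply: (@le_trans _ _ (\sum_(0 <= k < n) `|M| ^+ 2 * `|f k| ^+ 2)).
  apply: ler_sum => k _; rewrite -exprMn ler_pXn2r ?nnegrE ?mulr_ge0//.
by rewrite -mulr_sumr ler_wpM2l ?exprn_ge0.
Qed.

(** [A] is a bounded map rather than a bounded operator, so as to cover an
    orthogonal projection given by pointwise choice. *)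
Definition hmap (f : hardy E) : hardy F := Hardy (hmap_summable f).

Hypothesis AL : forall (c : C) x y, A (c *: x + y) = c *: A x + A y.

Lemma hmap_linear (c : C) (f g : hardy E) :
  hmap (c *: f + g) = c *: hmap f + hmap g.
Proof. by apply: hardyP => k; rewrite coefZD /= -AL. Qed.

Lemma hmap_le f : `|hmap f| <= `|M| * `|f|.
Proof.
apply: hardy_norm_le; first by rewrite mulr_ge0.
move=> n; apply: (@le_trans _ _ (\sum_(0 <= k < n) `|M| ^+ 2 * `|f k| ^+ 2)).
  apply: ler_sum => k _; rewrite -exprMn ler_pXn2r ?nnegrE ?mulr_ge0//.
  exact: AM_norm.
rewrite -mulr_sumr exprMn ler_wpM2l ?exprn_ge0//.
by rewrite hardy_normE partial_sum_le.
Qed.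

Lemma hmap_hmono n x : hmap (hmono n x) = hmono n (A x).
Proof.
apply: hardyP => k /=; rewrite !hmonoE; case: ifP => // _.
by rewrite -(mk_linearE AL) linear0.
Qed.

(** Both sides are bounded and linear in [f], and agree on monomials. *)
Lemma heval_hmap f z : disc R z -> heval (hmap f) z = A (heval f z).
Proof.
move=> z1; have Z0 : 0 <= (1 - `|z|)^-1 by rewrite invr_ge0 subr_ge0 ltW.
apply: (@eq_on_monomials _ _ _ (fun f => heval (hmap f) z)
   (fun f => A (heval f z)) ((1 - `|z|)^-1 * `|M|) (`|M| * (1 - `|z|)^-1)).
- by move=> c g h; rewrite hmap_linear heval_linear.
- by move=> c g h; rewrite heval_linear// AL.
- move=> g; apply: le_trans (heval_le _ z1) _.
  by rewrite -mulrA ler_wpM2l// hmap_le.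
- move=> g; apply: (@le_trans _ _ (`|M| * `|heval g z|)).
    exact: AM_norm.
  by rewrite -mulrA ler_wpM2l// heval_le.
- by move=> n x; rewrite hmap_hmono !heval_hmono -!(mk_linearE AL) linearZ.
Qed.

End hmap.
End coefficientwise.

Section subspace_valued.
Variables (R : realType) (E : hilbertType R).
Local Notation C := R[i].
Implicit Types (N K : set E) (M : set (hardy E)).

(** [H^2(D; N)] inside [H^2(D; E)]. *)
Definition hvalued N : set (hardy E) := [set f | forall n, N (f n)].

Lemma hvalued_subspace N : closed_subspace N -> closed_subspace (hvalued N).
Proof.
move=> Nc; have cf n : closed_subspace ((fun f : hardy E => f n) @^-1` N).
  apply: (@preimage_subspace _ _ _ _ _ 1) => // f.
  by rewrite mul1r coef_norm_le.
split.
- rewrite (_ : hvalued N = \bigcap_n ((fun f : hardy E => f n) @^-1` N)).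
    by apply: closed_bigI => n _; case: (cf n).
  by apply/seteqP; split => [f fN n _|f fN n]; [exact: fN|exact: (fN n I)].
- by move=> n; case: Nc.
- by move=> c f g fN gN n; case: (cf n) => _ _; apply; [exact: fN|exact: gN].
Qed.

Lemma hvalued_orth N K : orth N K -> orth (hvalued N) (hvalued K).
Proof.
move=> NK f g fN gK; apply: hardy_dotE.
apply: (@cvg_eventually_cst _ _ _ _ 0%N) => n _; rewrite /series /= big1// => k _.
exact: NK.
Qed.

Lemma hvalued_heval N f z : closed_subspace N -> disc R z ->
  hvalued N f -> N (heval f z).
Proof.
move=> Nc z1 fN; have [cN _ _] := Nc.
apply: (closed_lim cN _ (@wsum_cvg _ _ _ _ f (geometric_abs_summable z1))) => n.
by rewrite /series /=; apply: subsp_sum => // k; exact: subspZ.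
Qed.

Definition shift_invariant M := forall f, M f -> M (hshift f).

Lemma hmono_in M n x : shift_invariant M -> M (hconst x) -> M (hmono n x).
Proof. by move=> MS Mx; elim: n => // n IH; exact: MS. Qed.

(** Monomials with coefficients in [N] are shifts of constants, and they span
    [H^2(D; N)]. *)
Lemma hvalued_sub M N : closed_subspace M -> shift_invariant M ->
  (forall x, N x -> M (hconst x)) -> hvalued N `<=` M.
Proof.
move=> Mc MS NM f fN; have [cM _ _] := Mc.
apply: (@closed_lim _ _ M (hpart f) f cM) => [n|]; last exact: hpart_cvg.
apply: subsp_sum => // k; apply: hmono_in => //; exact: NM.
Qed.

(** Constants of [M] propagate under the shift, so the coefficientwise
    projection onto [N] preserves [M]. *)
Lemma shift_invariant_split M N : closed_subspace M -> shift_invariant M ->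
  closed_subspace N -> (forall x, N x -> M (hconst x)) ->
  orth_sum2 M (hvalued N) (M `&` hvalued (orthc N)).
Proof.
move=> Mc MS Nc NM; have NsubM := hvalued_sub Mc MS NM.
have NK : orth N (orthc N) by move=> x y Nx Ky; rewrite hdotC Ky ?conjC0.
split; first by move=> f g fN [_ gK]; exact: (hvalued_orth NK).
apply/seteqP; split => [f Mf|_ [f fN [g [Mg _] <-]]]; last first.
  by apply: subspD => //; exact: NsubM.
have /choice[P PP] : forall x, exists y, N y /\ orthc N (x - y).
  by move=> x; have [y] := projection_ex x Nc; exists y.
have P1 x : `|P x| <= 1 * `|x|.
  rewrite mul1r -(@ler_pXn2r _ 2)// ?nnegrE//.
  have [NPx KPx] := PP x; have := pythagoras (NK _ _ NPx KPx).
  by rewrite addrC subrK => ->; rewrite lerDl exprn_ge0.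
have PN : hvalued N (hmap P1 f) by move=> n; case: (PP (f n)).
exists (hmap P1 f) => //; exists (f - hmap P1 f); last by rewrite addrC subrK.
split; first by apply: subspB => //; exact: NsubM.
by move=> n; rewrite hcoefB; case: (PP (f n)).
Qed.

Lemma shift_invariantI M N : shift_invariant M -> closed_subspace N ->
  shift_invariant (M `&` hvalued N).
Proof.
move=> MS Nc f [Mf fN]; split; first exact: MS.
by move=> [|n]; [case: Nc|exact: fN].
Qed.

End subspace_valued.

(** * Closed subspaces as Hilbert spaces *)

Record csubspace (R : realType) (V : hilbertType R) := CSubspace {
  csub_set :> set V ;
  csub_setP : closed_subspace csub_set }.

Section subspace_type.
Variables (R : realType) (V : hilbertType R) (A : csubspace V).
Local Notation C := R[i].

Definition csubb : {pred V} := [pred x | `[< csub_set A x >]].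

Record subspace_of := SubspaceOf {
  subval : V ;
  subvalP : subval \in csubb }.

HB.instance Definition _ := [isSub for subval].
HB.instance Definition _ := [Choice of subspace_of by <:].

Lemma csubb_submod_closed : submod_closed csubb.
Proof.
have [_ A0 AP] := csub_setP A.
by split; [rewrite inE|move=> c x y; rewrite !inE; exact: AP].
Qed.

HB.instance Definition _ :=
  GRing.isSubmodClosed.Build C V csubb csubb_submod_closed.
HB.instance Definition _ := [SubChoice_isSubLmodule of subspace_of by <:].

Local Notation S := subspace_of.

Lemma subval_in (x : S) : csub_set A (subval x).
Proof. by have := subvalP x; rewrite inE. Qed.

Lemma subvalL (c : C) (x y : S) : subval (c *: x + y) = c *: subval x + subval y.
Proof. by []. Qed.

Lemma subval_ex v : csub_set A v -> exists x : S, subval x = v.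
Proof.
move=> Av; have vP : v \in csubb by rewrite inE.
by exists (SubspaceOf vP).
Qed.

Definition sub_dot (x y : S) : C := hdot (subval x) (subval y).

Let sub_dot_bilinear : bilinear_for *%R (Num.conj \; *%R) sub_dot.
Proof. by split=> u a x y; rewrite /sub_dot subvalL ?linearPl ?linearPr. Qed.

HB.instance Definition _ := bilinear_isBilinear.Build C S S C *%R
  (Num.conj \; *%R) sub_dot sub_dot_bilinear.

Let sub_dot_hermitian x y : sub_dot x y = (-1) ^+ false * (sub_dot y x)^*.
Proof. by rewrite mul1r; exact: hdotC. Qed.

HB.instance Definition _ := isHermitianSesquilinear.Build C S false
  Num.conj sub_dot sub_dot_hermitian.

Let sub_dot_gt0 x : x != 0 -> 0 < sub_dot x x.
Proof. by move=> x0; rewrite dnorm_gt0. Qed.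

HB.instance Definition _ := isDotProduct.Build C S sub_dot sub_dot_gt0.
HB.instance Definition _ := Lmodule_isNormed.Build C S
  (dot_normD sub_dot) (dot_normZ sub_dot) (@dot_norm_eq0 _ _ sub_dot).

Lemma sub_normE (x : S) : `|x| ^+ 2 = sub_dot x x.
Proof. exact: dot_norm_sqr. Qed.

Lemma subval_norm (x : S) : `|subval x| = `|x|.
Proof. by apply/eqP; rewrite -(@eqrXn2 _ 2)// sub_normE -hdotE. Qed.

Lemma subspace_complete (F : set_system S) : ProperFilter F -> cauchy F -> cvg F.
Proof.
move=> FF /cauchy_ballP FC.
have /cvg_ex[v vP] : cvg (subval x @[x --> F]).
  apply: cauchy_cvg; apply/cauchy_ballP => e e0.
  have [[P Q] /= [FP FQ] PQ] := FC _ e0.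
  exists ([set subval x | x in P], [set subval x | x in Q]).
    by split; [apply: filterS FP|apply: filterS FQ] => x /=; exists x.
  move=> [_ _] /= [[x Px <-] [y Qy <-]]; have := PQ (x, y) (conj Px Qy).
  by rewrite -!ball_normE /= -subval_norm.
have [cA _ _] := csub_setP A.
have [x xv] : exists x : S, subval x = v.
  by apply/subval_ex/(closed_cvg _ cA _ _ vP)/nearW => x; exact: subval_in.
apply/cvg_ex; exists x; apply/cvgrPdist_lt => e e0.
move/cvgrPdist_lt : vP => /(_ _ e0); apply: filterS => y.
by rewrite -xv -[`|x - y|]subval_norm.
Qed.

HB.instance Definition _ := Uniform_isComplete.Build S subspace_complete.
HB.instance Definition _ :=
  CompleteNormedModule_isHilbert.Build R S (fun x => esym (sub_normE x)).

End subspace_type.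

(** * Separability *)

Section separability.
Variable R : realType.
Local Notation C := R[i].

Lemma separableP (V : hilbertType R) : separable V <->
  exists2 D : set V, countable D &
    forall (x : V) (e : R), 0 < e -> exists2 y, D y & rnorm (x - y) < e.
Proof.
split=> -[D cD DP]; exists D => //.
  move=> x e e0; have ec : 0 < e%:C :> C by rewrite ltcR.
  have [y [xy Dy]] : ball x e%:C `&` D !=set0.
    by apply: DP; [exists x; exact: ballxx|exact: ball_open].
  by exists y => //; move: xy; rewrite -ball_normE /= rnormE ltcR.
move=> O [x Ox] Oo; have [_ /gt0_complex[e e0 ->] eO] : exists2 e : C, 0 < e & ball x e `<=` O.
  by have /nbhs_ballP[e e0 eO] := open_nbhs_nbhs (conj Oo Ox); exists e.
have [y Dy xy] := DP x e e0; exists y; split => //; apply: eO.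
by rewrite -ball_normE /= rnormE ltcR.
Qed.

Lemma rnormD (V : normedModType C) (x y : V) : rnorm (x + y) <= rnorm x + rnorm y.
Proof. by rewrite -lecR rmorphD /= -!rnormE ler_normD. Qed.

Lemma separableC : separable (C : hilbertType R).
Proof.
apply/separableP.
exists [set (ratr q.1 +i* ratr q.2 : C) | q in [set: rat * rat]].
  exact: sub_countable (card_image_le _ _) (countableP _).
move=> x e e0; have e20 : 0 < e / 2 by rewrite divr_gt0.
have approx (a : R) : exists q : rat, `|a - ratr q| < e / 2.
  have : a - e / 2 < a + e / 2 by rewrite ltrBlDr -addrA ltrDl addr_gt0.
  move=> /rat_in_itvoo[q]; rewrite in_itv /= => /andP[aq qa]; exists q.
  by rewrite ltr_norml ltrBrDr addrC -ltrBrDr opprK qa /= ltrBlDl -ltrBlDr.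
have [[q1 h1] [q2 h2]] := (approx (complex.Re x), approx (complex.Im x)).
exists (ratr q1 +i* ratr q2); first by exists (q1, q2).
rewrite -ltcR -rnormE; apply: le_lt_trans (normC_le _) _; rewrite ltcR [e]splitr.
by case: x h1 h2 => a b /= h1 h2; rewrite ltrD.
Qed.

(** Polynomials with coefficients in a countable dense set are countable and
    dense; a finite sequence of indices encodes such a polynomial. *)
Lemma separable_hardy (E : hilbertType R) : separable E -> separable (hardy E).
Proof.
move=> /separableP[D cD DP]; apply/separableP.
(* an enumeration of [D], with junk value [0] at the indices of no element *)
have [d dP] : exists d : nat -> E, forall (x : E) (e : R), 0 < e ->
    exists n, rnorm (x - d n) < e.
  have /countable_injP[h hinj] := cD.
  exists (fun n => xget 0 [set y | D y /\ h y = n]) => x e e0.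
  have [y Dy xy] := DP x e e0; exists (h y).
  case: xgetP => [y' _ [Dy' /hinj ->]|/(_ y)]; rewrite ?inE//.
  by case.
pose G (s : seq nat) : hardy E := \sum_(0 <= k < size s) hmono k (d (nth 0%N s k)).
exists [set G s | s in [set: seq nat]].
  exact: sub_countable (card_image_le _ _) (countableP _).
move=> f e e0; have e20 : 0 < e / 2 by rewrite divr_gt0.
have [N /(_ N (leqnn N)) fN] :
    exists N, forall n, (N <= n)%N -> rnorm (hpart f n - f) <= e / 2.
  by have /seq_cvgP/(_ _ e20) : hpart f @ \oo --> f by exact: hpart_cvg.
(* each of the [N] coefficients may err by [e / (2 (N + 1))] *)
pose r := e / 2 / N.+1%:R; have r0 : 0 < r by rewrite divr_gt0.
have /choice[i iP] : forall k, exists n, rnorm (f k - d n) < r by move=> k; exact: dP.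
exists (G (mkseq i N)); first by exists (mkseq i N).
suff GN : rnorm (hpart f N - G (mkseq i N)) < e / 2.
  rewrite [e]splitr -[f - _](subrKA (hpart f N)).
  apply: le_lt_trans (rnormD _ _) (ler_ltD _ GN).
  by rewrite -lecR -rnormE distrC rnormE lecR.
have -> : hpart f N - G (mkseq i N) = \sum_(0 <= k < N) hmono k (f k - d (i k)).
  rewrite /G size_mkseq -sumrB !big_nat; apply: eq_bigr => k /andP[_ kN].
  by rewrite nth_mkseq// hmonoB.
rewrite -ltcR -rnormE; apply: le_lt_trans (ler_norm_sum _ _ _) _.
apply: (@le_lt_trans _ _ (\sum_(0 <= k < N) r%:C)).
  by apply: ler_sum => k _; rewrite hmono_norm rnormE lecR ltW.
rewrite sumr_const_nat subn0 -rmorphMn /= ltcR /r -mulr_natr mulrAC.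
by rewrite ltr_pdivrMr// ltr_pM2l// ltr_nat.
Qed.

(** Orthogonal projection does not increase distances to points of the subspace,
    so it maps a dense set onto a dense set. *)
Lemma separable_subspace (E : hilbertType R) (A : csubspace E) :
  separable E -> separable (subspace_of A).
Proof.
move=> /separableP[D cD DP]; apply/separableP.
have Ac := csub_setP A.
have /choice[P PP] : forall x : E, exists y : subspace_of A,
    forall a, csub_set A a -> hdot (x - subval y) a = 0.
  move=> x; have [y Ay yP] := projection_ex x Ac.
  by have [y' y'E] := subval_ex Ay; exists y' => a Aa; rewrite y'E; exact: yP.
exists (P @` D); first exact: sub_countable (card_image_le _ _) cD.
move=> x e e0; have [y Dy xy] := DP (subval x) e e0.
exists (P y); first by exists y.
apply: le_lt_trans xy; rewrite -lecR -!rnormE.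
rewrite -(@ler_pXn2r _ 2)// ?nnegrE//.
have -> : subval x - y = subval (x - P y) - (y - subval (P y)).
  by rewrite opprB addrA subrK.
rewrite [leRHS]pythagoras ?subval_norm; last first.
  rewrite linearNr /= hdotC PP ?rmorph0 ?oppr0//.
  by apply: subspB => //; exact: subval_in.
by rewrite lerDl exprn_ge0.
Qed.

End separability.

(** * Point evaluations *)

Section point_evaluation.
Variables (R : realType) (E : hilbertType R).
Local Notation C := R[i].
Implicit Types (f g : hardy E) (x : E) (z : C).

Lemma kernel_summable z x : disc R z ->
  (fun n => (z^*) ^+ n *: x) \in square_summableb.
Proof.
move=> z1; rewrite inE; exists ((1 - `| `|z| ^+ 2|)^-1 * `|x| ^+ 2) => n.
have z2 : `| `|z| ^+ 2| < 1 by rewrite normrX normr_id expr_lt1.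
apply: le_trans (_ : (\sum_(0 <= k < n) `|(`|z| ^+ 2) ^+ k|) * `|x| ^+ 2 <= _).
  rewrite mulr_suml; apply: ler_sum => k _.
  rewrite normrZ exprMn !normrX norm_conjC normr_id -!exprM mulnC lexx.
  by [].
rewrite ler_wpM2r ?exprn_ge0//; exact: geometric_abs_summable.
Qed.

(** The vector-valued Szego kernel, which represents evaluation at [z]. *)
Definition szego z x (z1 : disc R z) : hardy E := Hardy (kernel_summable x z1).

Lemma hdot_szego z (z1 : disc R z) f x :
  hdot f (szego x z1) = hdot (heval f z) x.
Proof.
apply: (@eq_on_monomials _ _ C (fun f => hdot f (szego x z1))
  (fun f => hdot (heval f z) x) `|szego x z1| ((1 - `|z|)^-1 * `|x|)).
- by move=> c g h; rewrite linearPl.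
- by move=> c g h; rewrite heval_linear// linearPl.
- by move=> g; rewrite mulrC hdot_norm_le.
- move=> g; apply: le_trans (hdot_norm_le _ _) _.
  by rewrite mulrAC ler_wpM2r// heval_le.
- move=> n y; rewrite hdot_hmono heval_hmono hdotZl hdotZr rmorphXn /=.
  by rewrite conjCK.
Qed.

(** The kernel [k] solves [k = x + z^* S k]; evaluate this at [z]. *)
Lemma heval_szego z (z1 : disc R z) x :
  heval (szego x z1) z = (1 - `|z| ^+ 2)^-1 *: x.
Proof.
have kE : szego x z1 = hconst x + z^* *: hshift (szego x z1).
  apply: hardyP => -[|k]; rewrite hcoefD hcoefZ /=.
    by rewrite scale1r scaler0 addr0.
  by rewrite scalerA -exprS add0r.
have := congr1 (fun f => heval f z) kE.
rewrite /= -[hconst x]scale1r heval_linear// heval_Z// heval_const heval_shift//.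
rewrite scale1r scalerA [z^* * _]mulrC -normCK => /eqP.
move: (heval (szego x z1) z) => k.
rewrite -subr_eq -{1}[k]scale1r -scalerBl => /eqP <-.
rewrite scalerA mulVf ?scale1r// subr_eq0 eq_sym lt_eqF//.
by rewrite expr_lt1.
Qed.

Lemma szego_norm z (z1 : disc R z) x :
  `|szego x z1| ^+ 2 = (1 - `|z| ^+ 2)^-1 * `|x| ^+ 2.
Proof. by rewrite -[LHS]hdotE hdot_szego heval_szego hdotZl hdotE. Qed.

Lemma szego_coef z (z1 : disc R z) : 0 < (1 - `|z| ^+ 2)^-1.
Proof. by rewrite invr_gt0 subr_gt0 expr_lt1. Qed.

(** The remainder is quadratic in [h], uniformly in [f]: its weights
    [w ^+ n - z ^+ n - h * (n z^(n-1))], with [w = z + h], are bounded by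
    [|h|^2] times the solution of two nested linear recursions of ratio
    [r < 1]. *)
Lemma heval_taylor z : disc R z ->
  exists (L : hardy E -> E) (B K d : C),
  [/\ forall (c : C) f g, L (c *: f + g) = c *: L f + L g,
      forall f, `|L f| <= B * `|f|, 0 < d /\ 0 < K &
      forall h f, `|h| < d ->
        disc R (z + h) /\
        `|heval f (z + h) - heval f z - h *: L f| <= K * `|h| ^+ 2 * `|f|].
Proof.
move=> z1; have [r zr r1] : exists2 r, `|z| < r & r < 1.
  by exists ((`|z| + 1) / 2); rewrite (midf_lt z1).
have r0 : 0 <= r by rewrite (le_trans _ (ltW zr)).
have r1' : 0 < 1 - r by rewrite subr_gt0.
(* [v n] is [n z^(n-1)], [d n] bounds [(w^n - z^n) / h], and [e n] bounds the
   second order remainder divided by [h^2], as long as [|z|, |w| <= r] *)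
pose v := fix v n := if n is m.+1 then z * v m + z ^+ m else 0.
pose d := fix d n := if n is m.+1 then r * d m + r ^+ m else 0.
pose e := fix e n := if n is m.+1 then r * e m + d m else 0.
have dsum n : \sum_(0 <= k < n) d k <= (1 - r)^-1 / (1 - r).
  have := @recursion_sum_le _ r d (fun n => r ^+ n) (1 - r)^-1.
  rewrite /= add0r; apply => //; rewrite ?r0 ?r1 ?invr_ge0 ?ltW// => m.
  have := @geometric_abs_summable _ r; rewrite ger0_norm// => /(_ r1 m).
  by apply: le_trans; apply: ler_sum => k _; rewrite ger0_norm ?exprn_ge0.
have esum n : \sum_(0 <= k < n) e k <= (1 - r)^-1 / (1 - r) / (1 - r).
  have := @recursion_sum_le _ r e d ((1 - r)^-1 / (1 - r)).
  rewrite /= add0r; apply => //; rewrite ?r0 ?r1//.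
  by rewrite divr_ge0 ?invr_ge0 ?ltW.
have vd n : `|v n| <= d n.
  elim: n => [|n IH] /=; first by rewrite normr0.
  apply: le_trans (ler_normD _ _) _; rewrite normrM normrX.
  rewrite lerD//; first by rewrite ler_pM// ltW.
  by rewrite lerXn2r ?nnegrE// ltW.
have vS : abs_summable v ((1 - r)^-1 / (1 - r)).
  by move=> n; apply: le_trans (dsum n); apply: ler_sum => k _.
exists (wsum v), ((1 - r)^-1 / (1 - r)), ((1 - r)^-1 / (1 - r) / (1 - r)), (r - `|z|).
split.
- exact: wsum_linear vS.
- by move=> f; exact: wsum_norm_le.
- by rewrite subr_gt0 zr !divr_gt0 ?invr_gt0.
move=> h f hd; set w := z + h.
have wr : `|w| < r.
  by apply: le_lt_trans (ler_normD _ _) _; rewrite -ltrBrDl.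
have w1 : disc R w by rewrite /disc /= (lt_trans wr).
split => //; pose t n := w ^+ n - z ^+ n - h * v n.
have wzd n : `|w ^+ n - z ^+ n| <= `|h| * d n.
  elim: n => [|n IH]; first by rewrite !expr0 subrr normr0 mulr0.
  rewrite !exprS (_ : _ - _ = w * (w ^+ n - z ^+ n) + h * z ^+ n); last first.
    by rewrite /w; ring.
  apply: le_trans (ler_normD _ _) _; rewrite !normrM /= mulrDr.
  rewrite mulrCA lerD//; first by rewrite ler_pM// ltW.
  by rewrite ler_wpM2l// normrX lerXn2r ?nnegrE// ltW.
have te n : `|t n| <= `|h| ^+ 2 * e n.
  elim: n => [|n IH]; first by rewrite /t !expr0 /= subrr mulr0 subrr normr0 mulr0.
  rewrite (_ : t n.+1 = z * t n + h * (w ^+ n - z ^+ n)); last first.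
    by rewrite /t /= !exprS /w; ring.
  apply: le_trans (ler_normD _ _) _; rewrite !normrM /= mulrDr.
  rewrite mulrCA lerD//; first by rewrite ler_pM// ltW.
  by rewrite expr2 -mulrA ler_wpM2l.
have tS : abs_summable t (`|h| ^+ 2 * ((1 - r)^-1 / (1 - r) / (1 - r))).
  move=> n; apply: le_trans (_ : _ <= \sum_(0 <= k < n) `|h| ^+ 2 * e k) _.
    by apply: ler_sum => k _.
  by rewrite -mulr_sumr ler_wpM2l ?exprn_ge0.
have -> : heval f w - heval f z - h *: wsum v f = wsum t f.
  apply/esym/wsumE.
  rewrite (_ : series _ = (fun n => series (fun n => w ^+ n *: f n) n -
     series (fun n => z ^+ n *: f n) n - h *: series (fun n => v n *: f n) n)).
    apply: cvgB; first apply: cvgB.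
    - exact: wsum_cvg (geometric_abs_summable w1).
    - exact: wsum_cvg (geometric_abs_summable z1).
    - by apply: cvgZr; exact: wsum_cvg vS.
  apply/funext => n; rewrite /series /= scaler_sumr -!sumrB.
  by apply: eq_bigr => k _; rewrite scalerA -!scalerBl.
by rewrite [_ * `|h| ^+ 2]mulrC; exact: wsum_norm_le.
Qed.

End point_evaluation.

Section continuity.
Variables (R : realType) (E F : hilbertType R).
Local Notation C := R[i].

Lemma bounded_continuous (L : {linear E -> F}) (B : C) :
  (forall x, `|L x| <= B * `|x|) -> continuous L.
Proof.
move=> LB x; apply/cvgrPdist_lt => e e0.
have B0 : 0 < `|B| + 1 by rewrite ltr_wpDl.
have e1 : 0 < e / (`|B| + 1) by rewrite divr_gt0.
apply/nbhs_ballP; exists (e / (`|B| + 1)) => //= y.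
rewrite -ball_normE /= ltr_pdivlMr// => xy; rewrite -linearB.
apply: le_lt_trans xy; have H := LB (x - y).
have H0 : 0 <= B * `|x - y| by apply: le_trans H.
apply: le_trans H _; rewrite -[leLHS]ger0_norm// normrM normr_id mulrC.
by rewrite ler_wpM2l// lerDl.
Qed.

End continuity.

(** * The isometry attached to a wandering subspace *)

Local Notation shiftn n := (iter n (@hshift _ _)).

Section wandering.
Variables (R : realType) (E F : hilbertType R).
Local Notation C := R[i].
Implicit Types (f : hardy E) (x y : E).

Lemma shiftn_linear n (c : C) (g h : hardy F) :
  shiftn n (c *: g + h) = c *: shiftn n g + shiftn n h.
Proof. by elim: n => // n IH; rewrite /= IH hshift_linear. Qed.

Lemma shiftn_dot n (g h : hardy F) : hdot (shiftn n g) (shiftn n h) = hdot g h.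
Proof. by elim: n => // n IH; rewrite /= hshift_dot. Qed.

Lemma shiftn_norm n (g : hardy F) : `|shiftn n g| = `|g|.
Proof. by elim: n => // n IH; rewrite /= hshift_norm. Qed.

Lemma heval_shiftn n (g : hardy F) z :
  disc R z -> heval (shiftn n g) z = z ^+ n *: heval g z.
Proof.
move=> z1; elim: n => [|n IH]; first by rewrite scale1r.
by rewrite /= heval_shift// IH scalerA exprS.
Qed.

Definition wandering_isometry (V : E -> hardy F) : Prop :=
  [/\ forall (c : C) x y, V (c *: x + y) = c *: V x + V y,
      forall x, `|V x| = `|x| &
      forall n x y, hdot (V x) (shiftn n.+1 (V y)) = 0].

Definition model_part (V : E -> hardy F) f n : hardy F :=
  \sum_(0 <= k < n) shiftn k (V (f k)).

(** Pythagoras: the ranges of [S^k V] are mutually orthogonal. *)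
Lemma model_part_norm V f m n : wandering_isometry V -> (m <= n)%N ->
  `|model_part V f n - model_part V f m| ^+ 2 = \sum_(m <= k < n) `|f k| ^+ 2.
Proof.
case=> VL VN VO mn.
have -> : model_part V f n - model_part V f m =
    \sum_(m <= k < n) shiftn k (V (f k)).
  by rewrite /model_part (big_cat_nat (leq0n m) mn) /= addrAC subrr add0r.
rewrite -(subnKC mn); elim: (n - m)%N => [|p IH].
  by rewrite addn0 !big_geq// normr0 expr0n.
rewrite addnS !big_nat_recr ?leq_addr//= pythagoras ?IH ?shiftn_norm ?VN//.
rewrite linear_sumlz /= big_nat big1// => k /andP[_ kp].
rewrite -(subnKC kp) addSnnS iterD shiftn_dot; exact: VO.
Qed.

End wandering.

Section model.
Variables (R : realType) (E F : hilbertType R).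
Local Notation C := R[i].
Implicit Types (f : hardy E) (x y : E).
(** In this basic example the partial sums are the Taylor polynomials, so that
    [model_part_norm] compares any other example with [H^2(D; E)] itself. *)
Lemma hconst_wandering : wandering_isometry (@hconst R E).
Proof.
split=> [c x y|x|n x y].
- by apply: hardyP => -[|k]; rewrite hcoefD hcoefZ //= scaler0 addr0.
- exact: (hmono_norm 0).
- by rewrite (hdot_hmono 0) linear0r.
Qed.

(** The partial sums are as far apart as the Taylor polynomials of [f], hence
    form a Cauchy sequence; the limit is [sum_n S^n V (f n)]. *)
Lemma model_map_ex (V : E -> hardy F) : wandering_isometry V ->
  exists T : hardy E -> hardy F, forall f, model_part V f @ \oo --> T f.
Proof.
move=> VW; have /choice[T TP] f : exists g : hardy F, model_part V f @ \oo --> g; last by exists T.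
 apply: seq_complete => e e0.
have dist m n : `|model_part V f m - model_part V f n| =
    `|hpart f m - hpart f n|.
  wlog mn : m n / (n <= m)%N => [H|].
    by case/orP: (leq_total n m) => /H//; rewrite distrC => ->; rewrite distrC.
  apply/eqP; rewrite -(@eqrXn2 _ 2)// model_part_norm//.
  by rewrite (model_part_norm f hconst_wandering mn).
have /seq_cvgP fc : hpart f @ \oo --> f by exact: hpart_cvg.
have [|N NP] := fc (e / 2); first by rewrite divr_gt0.
exists N => m n Nm Nn; rewrite -lecR -rnormE dist.
apply: le_trans (ler_distD f _ _) _; rewrite [`|f - _|]distrC !rnormE.
by rewrite -rmorphD lecR [e]splitr lerD// NP.
Qed.

Section model_map.
Variables (V : E -> hardy F) (T : hardy E -> hardy F).
Hypotheses (VW : wandering_isometry V)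
  (TP : forall f, model_part V f @ \oo --> T f).

Lemma model_linear (c : C) (f g : hardy E) : T (c *: f + g) = c *: T f + T g.
Proof.
have [VL _ _] := VW; apply: (@seq_cvg_unique _ _ (model_part V (c *: f + g))).
  exact: TP.
rewrite (_ : model_part V _ =
   (fun n => c *: model_part V f n + model_part V g n)).
  by apply: cvgD; [apply: cvgZr|]; exact: TP.
apply/funext => n; rewrite /model_part scaler_sumr -big_split /=.
by apply: eq_bigr => k _; rewrite VL shiftn_linear.
Qed.

Lemma model_norm f : `|T f| = `|f|.
Proof.
apply: (@seq_cvg_unique _ C (fun n => `|model_part V f n|)).
  by apply: cvg_norm; exact: TP.
rewrite (_ : (fun n => _) = (fun n => `|hpart f n|)).
  by apply: cvg_norm; exact: hpart_cvg.
apply/funext => n; apply/eqP; rewrite -(@eqrXn2 _ 2)//.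
have := model_part_norm f VW (leq0n n).
rewrite -(model_part_norm f hconst_wandering (leq0n n)).
by rewrite /model_part !(big_geq (leqnn 0)) !subr0 => ->.
Qed.

Lemma model_hmono n x : T (hmono n x) = shiftn n (V x).
Proof.
apply: (@seq_cvg_unique _ _ (model_part V (hmono n x))); first exact: TP.
apply: (@cvg_eventually_cst _ _ _ _ n.+1) => m nm.
have [VL _ _] := VW.
rewrite /model_part (bigD1_seq n) ?iota_uniq ?mem_index_iota//= hmonoE eqxx.
rewrite big1 ?addr0// => k /negPf kn.
rewrite hmonoE kn -(mk_linearE VL) linear0.
by rewrite -(mk_linearE (shiftn_linear k)) linear0.
Qed.

Lemma model_shift f : T (hshift f) = hshift (T f).
Proof.
apply: (@eq_on_monomials _ _ _ (fun f => T (hshift f)) (fun f => hshift (T f)) 1 1).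
- by move=> c g h; rewrite hshift_linear model_linear.
- by move=> c g h; rewrite model_linear hshift_linear.
- by move=> g; rewrite model_norm hshift_norm mul1r.
- by move=> g; rewrite hshift_norm model_norm mul1r.
- by move=> n x; rewrite (model_hmono n.+1) model_hmono.
Qed.

Lemma model_heval f z : disc R z -> heval (T f) z = heval (V (heval f z)) z.
Proof.
move=> z1; have [VL VN _] := VW.
have Z0 : 0 <= (1 - `|z|)^-1 by rewrite invr_ge0 subr_ge0 ltW.
apply: (@eq_on_monomials _ _ _ (fun f => heval (T f) z)
  (fun f => heval (V (heval f z)) z) (1 - `|z|)^-1
  ((1 - `|z|)^-1 * (1 - `|z|)^-1)).
- by move=> c g h; rewrite model_linear heval_linear.
- by move=> c g h; rewrite heval_linear// VL heval_linear.
- by move=> g; rewrite -model_norm heval_le.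
- move=> g; apply: le_trans (heval_le _ z1) _.
  by rewrite VN -mulrA ler_wpM2l// heval_le.
- move=> n x; rewrite model_hmono heval_shiftn// heval_hmono.
  by rewrite -!(mk_linearE VL) linearZ /= heval_Z.
Qed.

(** Let [k_x] be the Szego kernel at [z] in direction [x] and
    [q = 1 / (1 - |z|^2)]. For [y = V x (z)], the inner product of [T k_x] and [k_y]
    is [q |y|^2], while Cauchy-Schwarz bounds it by [|k_x| |k_y| = q |x| |y|]. *)
Lemma model_contractive x z : disc R z -> `|heval (V x) z| <= `|x|.
Proof.
move=> z1; have [VL _ _] := VW; set y := heval (V x) z.
have q0 := szego_coef z1; set q := (1 - _)^-1 in q0.
have /= Ty := model_heval (szego x z1) z1.
have : `|hdot (T (szego x z1)) (szego y z1)| ^+ 2 <=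
    (`|szego x z1| * `|szego y z1|) ^+ 2.
  by rewrite ler_pXn2r ?nnegrE ?mulr_ge0// -[`|szego x z1|]model_norm hdot_norm_le.
rewrite hdot_szego Ty heval_szego -(mk_linearE VL) linearZ /= heval_Z//.
rewrite hdotZl hdotE exprMn !szego_norm normrM (gtr0_norm q0) normrX normr_id.
have [->|y0] := eqVneq y 0; first by rewrite normr0 => _; exact: normr_ge0.
rewrite -/q (_ : (q * `|y| ^+ 2) ^+ 2 = `|y| ^+ 2 * (q ^+ 2 * `|y| ^+ 2)); last by ring.
rewrite (_ : q * `|x| ^+ 2 * (q * `|y| ^+ 2) = `|x| ^+ 2 * (q ^+ 2 * `|y| ^+ 2)); last by ring.
rewrite ler_pM2r; last by rewrite mulr_gt0// exprn_gt0// normr_gt0.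
by rewrite ler_pXn2r ?nnegrE.
Qed.

End model_map.
End model.

(** * The Wold decomposition and the Beurling-Lax theorem *)

Section wold.
Variables (R : realType) (F : hilbertType R) (M : set (hardy F)).
Local Notation C := R[i].
Hypotheses (Mc : closed_subspace M) (MS : shift_invariant M).

Lemma shift_range_subspace : closed_subspace (@hshift R F @` M).
Proof.
by apply: isometry_closed Mc => [c f g|f]; [exact: hshift_linear|exact: hshift_norm].
Qed.

Definition wandering_subspace : csubspace (hardy F) :=
  CSubspace (subspaceI Mc (orthc_subspace (@hshift R F @` M))).

Let E := subspace_of wandering_subspace.

Lemma shiftn_in n f : M f -> M (shiftn n f).
Proof. by move=> Mf; elim: n => // n; exact: MS. Qed.

Lemma wandering_subspaceP : wandering_isometry (fun x : E => subval x).
Proof.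
split=> [//|x|n x y]; first exact: subval_norm.
have [_ xo] := subval_in x; have [My _] := subval_in y.
by apply: xo; exists (shiftn n (subval y)) => //; exact: shiftn_in.
Qed.

(** An element of [M] orthogonal to the range of [T] is orthogonal to the
    wandering subspace, hence of the form [S h] with [h] in [M]; and [h] is again
    orthogonal to the range, as [T] commutes with [S]. Iterating, all its
    coefficients vanish. *)
Lemma wold (T : hardy E -> hardy F) :
  (forall f, model_part (fun x : E => subval x) f @ \oo --> T f) ->
  M = range T.
Proof.
move=> TP; have VW := wandering_subspaceP.
have [cM _ _] := Mc.
have TM f : M (T f).
  apply: (closed_lim cM _ (TP f)) => n; apply: subsp_sum => // k.
  by apply: shiftn_in; case: (subval_in (f k)).
have rT : closed_subspace (range T).
  apply: isometry_closed (subspace_setT _) => [c f g|f].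
    exact: (model_linear VW TP).
  exact: (model_norm VW TP).
have step g : M g -> orthc (range T) g ->
    exists2 h, M h /\ orthc (range T) h & g = hshift h.
  move=> Mg gT; have [_ [h Mh <-] gh] := projection_ex g shift_range_subspace.
  have [x xE] : exists x : E, subval x = g - hshift h.
    by apply: subval_ex; split => //; apply: subspB => //; exact: MS.
  have gE : g = hshift h.
    apply/eqP; rewrite -subr_eq0 -normr_eq0 -sqrf_eq0 -hdotE; apply/eqP.
    rewrite linearBr /= (gh (hshift h)) ?subr0; last by exists h.
    apply/hdot_sym0/gT; exists (hconst x) => //.
    by rewrite (model_hmono VW TP 0) /= xE.
  exists h => //; split=> // _ [f _ <-]; rewrite -hshift_dot -gE.
  by apply: gT; exists (hshift f) => //; rewrite (model_shift VW TP).
have zero n : forall g, M g -> orthc (range T) g -> g n = 0.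
  elim: n => [|n IH] g Mg gT; have [h [Mh hT] ->] := step g Mg gT; first by [].
  exact: IH.
apply/seteqP; split => [g Mg|_ [f _ <-]]; last exact: TM.
have [_ [f _ <-] gf] := projection_ex g rT.
suff -> : g = T f by exists f.
apply/eqP; rewrite -subr_eq0; apply/eqP/hardyP => n.
by apply: zero => //; apply: subspB.
Qed.

End wold.

Section beurling_lax.
Variables (R : realType) (F : hilbertType R).
Local Notation C := R[i].

(** Outside of the disc the series need not converge and its formal sum need not
    be linear in [x], whence the value [0] there. *)
Definition eval_fun (E : hilbertType R) (V : E -> hardy F) (z : C) (x : E) : F :=
  if `|z| < 1 then heval (V x) z else 0.

Lemma eval_fun_linear (E : hilbertType R) (V : E -> hardy F) z :
  (forall (c : C) x y, V (c *: x + y) = c *: V x + V y) ->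
  forall (c : C) x y, eval_fun V z (c *: x + y) = c *: eval_fun V z x + eval_fun V z y.
Proof.
move=> VL c x y; rewrite /eval_fun; case: ifP => z1; last by rewrite scaler0 addr0.
by rewrite VL heval_linear.
Qed.

(** [M] is the range of the isometry attached to its wandering subspace, and
    that isometry is multiplication by [Psi z x = x(z)]. *)
Theorem beurling_lax (K : set F) (M : set (hardy F)) : separable F ->
  closed_subspace K -> closed_subspace M -> shift_invariant M ->
  M `<=` hvalued K ->
  exists (E : hilbertType R) (Psi : C -> {linear E -> F}),
    [/\ separable E, op_inner K Psi & M = op_mulH2 Psi].
Proof.
move=> Fsep Kc Mc MS MK.
pose E := subspace_of (wandering_subspace Mc).
pose V (x : E) := subval x.
have VW : wandering_isometry V := wandering_subspaceP Mc MS.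
have [VL VN _] := VW.
have [T TP] := model_map_ex VW.
have MT : M = range T := wold MS TP.
pose Psi z : {linear E -> F} := mk_linear (eval_fun_linear z VL).
have PsiE z x : disc R z -> Psi z x = heval (V x) z.
  by move=> z1; rewrite /Psi /= /eval_fun ifT.
have TE f z : disc R z -> heval (T f) z = Psi z (heval f z).
  by move=> z1; rewrite (model_heval VW TP)// PsiE.
exists E, Psi; split.
- exact: separable_subspace (separable_hardy Fsep).
- split; last first.
    move=> f; exists (T f); split; first by apply: MK; rewrite MT; exists f.
      exact: TE.
    exact: (model_norm VW TP).
  split=> [z z1 x||z z1].
  + by rewrite PsiE//; apply: hvalued_heval => //; apply: MK; case: (subval_in x).
  + by exists 1 => z z1 x; rewrite PsiE// mul1r (model_contractive VW TP).
  + have [L [B [k [d [LL LB [d0 k0] H]]]]] := heval_taylor F z1.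
    have LVL (c : C) x y : (L \o V) (c *: x + y) = c *: (L \o V) x + (L \o V) y.
      by rewrite /comp VL LL.
    exists (mk_linear LVL).
      by apply: (@bounded_continuous _ _ _ _ B) => x; rewrite /= -VN.
    move=> e e0; near=> h => x.
    have hd : `|h| < d by near: h; exact: nbhs0_lt.
    have he : `|h| < e / k by near: h; apply: nbhs0_lt; rewrite divr_gt0.
    have [zh1 {}H] := H h (V x) hd; rewrite !PsiE//=.
    apply: le_trans H _; rewrite VN ler_wpM2r// expr2 mulrA ler_wpM2r//.
    by rewrite mulrC -ler_pdivlMr// ltW.
- apply: (etrans MT); apply/seteqP; split => [_ [f _ <-]|G [f fG]].
    by exists f => z z1; exact: TE.
  by exists f => //; apply: heval_inj => z z1; rewrite TE// fG.
Unshelve. all: by end_near. Qed.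

End beurling_lax.

(** * Multiplication operators on the bidisk *)

Section bidisk.
Variable R : realType.
Local Notation C := R[i].
Implicit Types (phi : C -> C).

Lemma heval2_inj (F G : H2D2 R) :
  (forall z1 z2, disc R z1 -> disc R z2 -> heval2 F z1 z2 = heval2 G z1 z2) ->
  F = G.
Proof. by move=> FG; apply: heval_inj => z1 d1; apply: heval_inj => z2; exact: FG. Qed.

(** The isometry [M_phi]; it is linear since functions on the disc determine
    their coefficients. *)
Lemma inner_mul_ex phi : inner phi -> exists W : H2 R -> H2 R,
  [/\ forall (c : C) f g, W (c *: f + g) = c *: W f + W g,
      forall f, `|W f| = `|f|,
      forall f z, disc R z -> heval (W f) z = phi z * heval f z &
      mulH2 phi = range W].
Proof.
case=> _ phiP.
have /choice[W WP] f : exists h : H2 R,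
    (forall z, disc R z -> heval h z = phi z * heval f z) /\ `|h| = `|f|.
  by have [h] := phiP f; exists h.
have WE f z : disc R z -> heval (W f) z = phi z * heval f z.
  by case: (WP f) => + _; apply.
exists W; split => //.
- move=> c f g; apply: heval_inj => z z1.
  by rewrite WE// !heval_linear// !WE//= mulrDr mulrCA.
- by move=> f; case: (WP f).
- apply/seteqP; split => [h [f hf]|_ [f _ <-]]; last by exists f => z; exact: WE.
  by exists f => //; apply: heval_inj => z z1; rewrite WE// hf.
Qed.

Lemma mulH2_subspace phi : inner phi -> closed_subspace (mulH2 phi).
Proof.
move=> /inner_mul_ex[W [WL WN _ ->]].
exact: isometry_closed (subspace_setT _).
Qed.

(** Multiplication by [phi(z2)] acts as [M_phi] on each coefficient in [z1]. *)
Lemma mul_z2_inner phi : inner phi -> mul_z2 phi setT = hvalued (mulH2 phi).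
Proof.
move=> /inner_mul_ex[W [WL WN WE ->]].
have W1 x : `|W x| <= 1 * `|x| by rewrite WN mul1r.
have WG (G : H2D2 R) z1 z2 : disc R z1 -> disc R z2 ->
    heval2 (hmap W1 G) z1 z2 = phi z2 * heval2 G z1 z2.
  by move=> d1 d2; rewrite /heval2 heval_hmap// WE.
apply/seteqP; split => [F [G _ FG]|F FW].
  have -> : F = hmap W1 G by apply: heval2_inj => z1 z2 d1 d2; rewrite FG// WG.
  by move=> n; exists (G n).
have /choice[g gP] n : exists h, W h = F n by have [h _ <-] := FW n; exists h.
have gS : g \in square_summableb.
  rewrite inE; have [M FM] := coef_summable F; exists M => n.
  by under eq_bigr do rewrite -WN gP; exact: FM.
have FE : F = hmap W1 (Hardy gS) by apply: hardyP => n; rewrite -gP.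
exists (Hardy gS); first by [].
by rewrite FE; exact: WG.
Qed.

(** The product [g(z2) h(z1)] has [z1]-coefficients [h n *: g], and conversely
    the coordinates along [g] of the coefficients are those of [h]. *)
Lemma mul_z2_line (g : H2 R) : mul_z2 (heval g) (H2z1 R) = hvalued (line g).
Proof.
pose A (a : C) : H2 R := a *: g.
have AL (c : C) x y : A (c *: x + y) = c *: A x + A y.
  by rewrite /A scalerDl scalerA.
have AM x : `|A x| <= `|g| * `|x| by rewrite /A normrZ mulrC.
have AE (h : H2 R) z1 z2 : disc R z1 -> disc R z2 ->
    heval2 (hmap AM h) z1 z2 = heval g z2 * heval h z1.
  by move=> d1 d2; rewrite [RHS]mulrC /heval2 (heval_hmap AM AL h d1) heval_Z.
have cL : forall (c : C) x y, hconst (c *: x + y) = c *: hconst x + hconst y :> H2 R.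
  by case: (@hconst_wandering R C).
have cN (x : C) : `|hconst x : H2 R| <= 1 * `|x|.
  by rewrite mul1r; case: (@hconst_wandering R C) => _ ->.
apply/seteqP; split => [F [G [h Gh] FG]|F FW].
  have -> : F = hmap AM h.
    apply: heval2_inj => z1 z2 d1 d2.
    by rewrite (FG z1 z2 d1 d2) (AE h z1 z2 d1 d2) (Gh z1 z2 d1 d2).
  by move=> n; exists (h n).
pose h : H2 R := hmap (line_coord_le g) F.
have FE : F = hmap AM h by apply: hardyP => n; exact: line_coordE.
have cE z1 z2 : disc R z1 -> disc R z2 -> heval2 (hmap cN h) z1 z2 = heval h z1.
  by move=> d1 d2; rewrite /heval2 (heval_hmap cN cL h d1) heval_const.
exists (hmap cN h); first by exists h.
by move=> z1 z2 d1 d2; rewrite FE (AE h z1 z2 d1 d2) (cE z1 z2 d1 d2).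
Qed.

End bidisk.

(** * Invariant subspaces of the 3-Brownian shift *)

Section brownian.
Variables (R : realType) (sigma theta : R).
Variables (M0 : set (H2D2 R)) (M1 : set (hsum (H2 R) R[i])).
Local Notation C := R[i].
Hypotheses (sigma0 : 0 < sigma) (Mc : closed_subspace (dsum M0 M1))
  (MT : invariant_under (brownian_shift3 sigma theta) (dsum M0 M1)).

Lemma dsum_zero : M0 0 /\ M1 0.
Proof. by case: Mc => _ []. Qed.

Lemma dsum1_subspace : closed_subspace M0.
Proof.
have [M00 M10] := dsum_zero.
have -> : M0 = (fun F => hpair F (0 : hsum (H2 R) C)) @^-1` dsum M0 M1.
  by apply/seteqP; split => F //= [].
apply: (preimage_subspace (M := 1)) Mc => [c F G|F].
  by rewrite -[RHS]/(hpair (c *: F + G) (c *: 0 + 0)) scaler0 addr0.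
by apply: le_trans (hsum_norm_le _) _; rewrite normr0 addr0 mul1r.
Qed.

(** The shift maps [(0, (f, a))] to a vector with first component
    [sigma f_{z2}]. *)
Lemma dsum1_const f a : M1 (hpair f a) -> M0 (hconst f).
Proof.
have [M00 _] := dsum_zero; move=> Mf.
have [/= + _] := MT (imageP _ (conj M00 Mf : dsum M0 M1 (hpair 0 (hpair f a)))).
move=> H; have -> : hconst f = sigma%:C^-1 *: (hshift 0 + sigma%:C *: hconst f).
  have -> : hshift (0 : H2D2 R) = 0 by apply: hardyP => -[].
  by rewrite add0r scalerA mulVf ?scale1r// gt_eqF// ltcR.
by apply: subspZ H; exact: dsum1_subspace.
Qed.

Lemma dsum1_shift : shift_invariant M0.
Proof.
move=> F MF; have [_ M10] := dsum_zero.
have [/= + _] := MT (imageP _ (conj MF M10 : dsum M0 M1 (hpair F 0))).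
have -> : hconst (0 : H2 R) = 0 by apply: hardyP => -[].
by rewrite scaler0 addr0.
Qed.

End brownian.

Section operator_inner.
Variables (R : realType) (E F : hilbertType R).

Lemma op_innerS (K L : set F) (Psi : R[i] -> {linear E -> F}) :
  K `<=` L -> op_inner K Psi -> op_inner L Psi.
Proof.
move=> KL [[PK PM PD] PI]; split.
  by split=> // z z1 x; apply/KL/PK.
by move=> f; have [G [GK GE GN]] := PI f; exists G; split=> // n; exact/KL/GK.
Qed.

End operator_inner.

Theorem theorem2p1 (R : realType) (sigma theta : R)
    (M0 : set (H2D2 R)) (M1 : set (hsum (H2 R) R[i])) :
  0 < sigma -> 0 <= theta < 2 * pi ->
  closed_subspace (dsum M0 M1) ->
  invariant_under (brownian_shift3 sigma theta) (dsum M0 M1) ->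
  closed_subspace M1 -> invariant_under (brownian_shift sigma theta) M1 ->
  (exists2 x, M1 x & x != 0) ->
  (forall phi : R[i] -> R[i], inner phi ->
    M1 = dsum (mulH2 phi) [set 0] ->
    exists (E : hilbertType R) (Psi : R[i] -> {linear E -> H2 R}),
      [/\ separable E,
          op_inner (Kphi phi) Psi &
          orth_sum2 M0 (mul_z2 phi setT) (op_mulH2 Psi)]) /\
  (forall (phi : R[i] -> R[i]) (c : R[i]) (g : H2 R), inner phi ->
    has_radial_limit phi (expi theta) c ->
    (forall z, disc R z ->
      heval g z = sigma%:C * ((c^* * phi z - 1) / (z - expi theta))) ->
    orth_sum2 M1 [set a *: hpair g (1 : R[i]) | a in [set: R[i]]]
                 (dsum (mulH2 phi) [set 0]) ->
    exists (E : hilbertType R) (Psi : R[i] -> {linear E -> H2 R}),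
      [/\ separable E,
          op_inner (Kphi phi) Psi,
          orth_sum3 M0 (mul_z2 phi setT) (mul_z2 (heval g) (H2z1 R))
                       (op_mulH2 Psi) &
          range (Psi 0) `<=` Kphi phi `&` orthc [set g]]).
Proof.
move=> sigma0 _ Mc MT _ _ _.
have M0c := dsum1_subspace Mc; have MS := dsum1_shift Mc MT.
have Mconst := dsum1_const sigma0 Mc MT.
have H2sep : separable (H2 R) := separable_hardy (separableC R).
split=> [phi phi_inner M1E|phi c g phi_inner _ _ [gN M1E]].
  have Nc := mulH2_subspace phi_inner.
  have NM f : mulH2 phi f -> M0 (hconst f).
    by move=> Nf; apply: (Mconst _ 0); rewrite M1E.
  have splitM := shift_invariant_split M0c MS Nc NM.
  have Kc : closed_subspace (Kphi phi) := orthc_subspace _.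
  have [E [Psi [Esep PsiI PsiM]]] := beurling_lax H2sep Kc
    (subspaceI M0c (hvalued_subspace Kc)) (shift_invariantI MS Kc) (@subIsetr _ _ _).
  by exists E, Psi; split => //; rewrite mul_z2_inner// -PsiM.
have Nc := mulH2_subspace phi_inner.
have N0 : mulH2 phi 0 by case: Nc.
have M1D x y : line (hpair g (1 : R[i])) x -> dsum (mulH2 phi) [set 0] y -> M1 (x + y).
  by move=> lx Dy; rewrite M1E; exists x => //; exists y.
have NM f : mulH2 phi f -> M0 (hconst f).
  move=> Nf; apply: (Mconst _ 0); rewrite -[hpair f 0]add0r; apply: M1D => //.
  by exists 0 => //; rewrite scale0r.
have gM : M0 (hconst g).
  apply: (Mconst _ 1); rewrite -[hpair g (1 : R[i])]addr0; apply: M1D => //.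
  by exists 1 => //; rewrite scale1r.
have gK : Kphi phi g.
  move=> f Nf.
  have : hdot (hpair g (1 : R[i])) (hpair f (0 : R[i])) = 0.
    by apply: gN => //; exists 1 => //; rewrite scale1r.
  by rewrite -[LHS]/(hdot g f + hdot (1 : R[i]) 0) linear0r addr0.
have [orthN M0E] := shift_invariant_split M0c MS Nc NM.
have Kc : closed_subspace (Kphi phi) := orthc_subspace _.
have M0c' := subspaceI M0c (hvalued_subspace Kc).
have MS' := shift_invariantI MS Kc.
have gM' x : line g x -> (M0 `&` hvalued (Kphi phi)) (hconst x).
  case=> a _ <-; split.
    have -> : hconst (a *: g) = a *: hconst g.
      by apply: hardyP => -[|k]; rewrite hcoefZ //= scaler0.
    exact: subspZ.
  by move=> [|n] /=; [exact: (subspZ a Kc gK)|case: Kc].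
have [orthg M0E'] := shift_invariant_split M0c' MS' (line_subspace g) gM'.
have gc := orthc_subspace (line g).
have K'c := subspaceI Kc gc.
have sub : M0 `&` hvalued (Kphi phi) `&` hvalued (orthc (line g)) `<=`
    hvalued (Kphi phi `&` orthc (line g)).
  by move=> F [[_ FK] Fg] n; split; [exact: FK|exact: Fg].
have [E [Psi [Esep PsiI PsiM]]] := beurling_lax H2sep K'c
  (subspaceI M0c' (hvalued_subspace gc)) (shift_invariantI MS' gc) sub.
exists E, Psi; split => //.
- exact: op_innerS PsiI.
- rewrite mul_z2_inner// mul_z2_line -PsiM; split.
  + apply: hvalued_orth => f _ Nf [a _ <-].
    by apply: hdot_sym0; rewrite hdotZl gK ?mulr0.
  + by move=> F G NF [MG _]; exact: orthN.
  + exact: orthg.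
  + apply: (etrans M0E); apply/seteqP; split => [_ [F NF [G MG <-]]|_ [_ [F NF [G gG <-]] [H MH <-]]].
      move: MG; rewrite {1}M0E' => -[G1 G1g [G2 G2M <-]].
      by rewrite addrA; exists (F + G1); [exists F => //; exists G1|exists G2].
    rewrite -addrA; exists F => //; exists (G + H) => //.
    by rewrite M0E'; exists G => //; exists H.
- have [[PK _ _] _] := PsiI; move=> _ [x _ <-].
  have d0 : disc R 0 by rewrite /disc /= normr0 ltr01.
  have [PKx Pgx] := PK 0 d0 x; split => // _ ->.
  by apply: Pgx; exists 1 => //; rewrite scale1r.
Qed.
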